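(* Let $k$ be a perfect field of characteristic two and let $\mathcal{N}=k^*\times k\times k^*\times(k/\mathrm{AS}(k))$. For $(a,b,c,d)\in\mathcal{N}$ let $C_{abcd}$ be the smooth projective curve of genus two over $k$ with quasi-affine model $y^2+y=ax^3+bx+\frac{c}{x}+d$. Then: 1. For any $(a,b,c,d),(a',b',c',d')\in\mathcal{N}$, the curves $C_{a'b'c'd'}$ and $C_{abcd}$ are $k$-isomorphic if and only if $(a',b',c',d')=(\lambda^3a,\lambda b,\lambda^{-1}c,d)$ for some $\lambda\in k^*$. 2. For any $(a,b,c,d)\in\mathcal{N}$, $\mathrm{Aut}_k(C_{abcd})=\langle\iota\rangle$.
   Context: $\mathrm{AS}(k)=\{x+x^2 : x\in k\}$. The fourth coordinate $d$ of an element of $\mathcal{N}$ is a class in $k/\mathrm{AS}(k)$; in the equation of the curve one uses any representative in $k$, which does not change the $k$-isomorphism class, and comparisons of fourth coordinates are in $k/\mathrm{AS}(k)$. The hyperelliptic involution is $\iota\colon(x,y)\mapsto(x,y+1)$. *)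

(* Defs.v *)
From HB Require Import structures.
From mathcomp Require Import all_boot all_order all_algebra all_field.
From mathcomp Require Import mpoly.
From mathcomp Require Import ring.

Set Implicit Arguments.
Unset Strict Implicit.
Unset Printing Implicit Defensive.

Import GRing.Theory.
Local Open Scope ring_scope.

(** * Fields *)

Definition perfect_field (k : fieldType) : Prop :=
  forall p : {poly k}, irreducible_poly p -> separable_poly p.

Definition algebraic_closure (k : fieldType) (K : closedFieldType)
    (f : {rmorphism k -> K}) : Prop :=
  forall z : K, algebraicOver f z.

(* Equality of the classes of d1 and d2 in the additive group k / AS(k),
   where AS(k) = {u + u^2 : u in k}; it is a subgroup in characteristic 2. *)
Definition in_AS (k : fieldType) (z : k) : Prop := exists u : k, z = u + u ^+ 2.
Definition eq_mod_AS (k : fieldType) (d1 d2 : k) : Prop := in_AS (d1 - d2).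

(** * Projective varieties over a field k, by their points over K

  A variety over k is given by homogeneous equations over k; its points and
  the maps between varieties are taken over an extension f : k -> K (in the
  application K is an algebraic closure of k).  A point of P^n(K) is a line of
  K^(n+1). *)

Definition projpt (K : fieldType) (n : nat) : Type :=
  {U : {vspace 'rV[K]_n.+1} | \dim U == 1%N}.

Lemma dim_line (K : fieldType) n (v : 'rV[K]_n.+1) :
  v != 0 -> \dim <[v]>%VS == 1%N.
Proof. by move=> v0; rewrite dim_vline v0. Qed.

Lemma delta_neq0 (K : fieldType) n : (delta_mx ord0 ord0 : 'rV[K]_n.+1) != 0.
Proof.
by apply/eqP => /rowP/(_ ord0) /eqP; rewrite !mxE !eqxx oner_eq0.
Qed.

(* The point [v_0 : ... : v_n]; meaningful only for v != 0. *)
Definition pt (K : fieldType) n (v : 'rV[K]_n.+1) : projpt K n :=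
  insubd (exist _ <[delta_mx ord0 ord0]>%VS (dim_line (delta_neq0 K n)) : projpt K n)
         <[v]>%VS.

(* A choice of homogeneous coordinates. *)
Definition coords (K : fieldType) n (P : projpt K n) : 'rV[K]_n.+1 :=
  vpick (val P).

Lemma coords_neq0 (K : fieldType) n (P : projpt K n) : coords P != 0.
Proof. by rewrite /coords vpick0 -dimv_eq0 (eqP (valP P)). Qed.

Lemma val_pt (K : fieldType) n (v : 'rV[K]_n.+1) :
  v != 0 -> val (pt v) = <[v]>%VS.
Proof. by move=> v0; rewrite /pt insubdK // unfold_in dim_line. Qed.

Lemma coordsK (K : fieldType) n (P : projpt K n) : pt (coords P) = P.
Proof.
apply: val_inj; rewrite val_pt ?coords_neq0 //; apply/eqP.
rewrite eqEdim -memvE memv_pick /=.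
by rewrite (eqP (dim_line (coords_neq0 P))) (eqP (valP P)).
Qed.

Lemma pt_eq (K : fieldType) n (v w : 'rV[K]_n.+1) : v != 0 -> w != 0 ->
  pt v = pt w <-> exists2 t, t != 0 & v = t *: w.
Proof.
move=> v0 w0; split=> [E | [t t0 ->]].
  have : v \in <[w]>%VS by rewrite -(val_pt w0) -E (val_pt v0) memv_line.
  case/vlineP=> t Ev; exists t => //.
  by apply: contraNneq v0 => t0; rewrite Ev t0 scale0r.
have tw0 : t *: w != 0 by rewrite scaler_eq0 negb_or t0.
apply: val_inj; rewrite !val_pt //; apply/eqP; rewrite eqEdim.
rewrite (eqP (dim_line w0)) (eqP (dim_line tw0)) leqnn andbT.
by rewrite -memvE memvZ // memv_line.
Qed.

Lemma coords_pt (K : fieldType) n (v : 'rV[K]_n.+1) : v != 0 ->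
  exists2 t, t != 0 & coords (pt v) = t *: v.
Proof. by move=> v0; apply/pt_eq; rewrite ?coords_neq0 // coordsK. Qed.

Section Varieties.
Variables (k K : fieldType) (f : {rmorphism k -> K}).

Definition evalp n (p : {mpoly k[n.+1]}) (v : 'rV[K]_n.+1) : K :=
  (map_mpoly f p).@[v 0].

Lemma evalpB n p q (v : 'rV[K]_n.+1) : evalp (p - q) v = evalp p v - evalp q v.
Proof. by rewrite /evalp rmorphB mevalB. Qed.

Lemma evalpD n p q (v : 'rV[K]_n.+1) : evalp (p + q) v = evalp p v + evalp q v.
Proof. by rewrite /evalp rmorphD mevalD. Qed.

Lemma evalpM n p q (v : 'rV[K]_n.+1) : evalp (p * q) v = evalp p v * evalp q v.
Proof. by rewrite /evalp rmorphM mevalM. Qed.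

Lemma evalpZ n a p (v : 'rV[K]_n.+1) : evalp (a *: p) v = f a * evalp p v.
Proof. by rewrite /evalp map_mpolyZ mevalZ. Qed.

Lemma evalpX n j (v : 'rV[K]_n.+1) : evalp 'X_j v = v 0 j.
Proof. by rewrite /evalp map_mpolyX mevalXU. Qed.

(* The zero locus of a list of homogeneous polynomials. *)
Definition zeros n (S : seq {mpoly k[n.+1]}) : pred (projpt K n) :=
  fun P => all (fun p => evalp p (coords P) == 0) S.

Definition evalv n m (F : 'I_m.+1 -> {mpoly k[n.+1]}) (v : 'rV[K]_n.+1) :
  'rV[K]_m.+1 := \row_i evalp (F i) v.

(* Morphisms X -> Y defined over k.  A map X -> Y is represented by a total
   map of the ambient spaces, of which only the restriction to X matters; it
   must be given, around each point P of X, by homogeneous polynomials over k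
   of a common degree that do not all vanish at P. *)
Definition morphism_over n m (X : pred (projpt K n)) (Y : pred (projpt K m))
    (phi : projpt K n -> projpt K m) : Prop :=
  {in X, forall P, phi P \in Y} /\
  {in X, forall P, exists (e : nat) (F : 'I_m.+1 -> {mpoly k[n.+1]}),
    [/\ forall i, F i \is e.-homog,
        evalv F (coords P) != 0
      & {in X, forall Q, evalv F (coords Q) != 0 ->
                         phi Q = pt (evalv F (coords Q))}]}.

Definition isomorphism_over n m (X : pred (projpt K n)) (Y : pred (projpt K m))
    (phi : projpt K n -> projpt K m) : Prop :=
  morphism_over X Y phi /\
  exists psi : projpt K m -> projpt K n,
    [/\ morphism_over Y X psi, {in X, cancel phi psi}
      & {in Y, cancel psi phi}].

Definition isomorphic_over n m (X : pred (projpt K n)) (Y : pred (projpt K m))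
    : Prop :=
  exists phi, isomorphism_over X Y phi.

Definition automorphism_over n (X : pred (projpt K n))
    (phi : projpt K n -> projpt K n) : Prop :=
  isomorphism_over X X phi.

(* phi belongs to the group of maps X -> X generated by iota, for an involution
   iota (so that the powers with natural exponents are all of the group). *)
Definition generated_by_involution n (X : pred (projpt K n))
    (iota phi : projpt K n -> projpt K n) : Prop :=
  exists e : nat, {in X, phi =1 iter e iota}.

(* Nonsingularity of a curve in P^n by the Jacobian criterion. *)
Definition jacobian n (S : seq {mpoly k[n.+1]}) (v : 'rV[K]_n.+1) :
  'M[K]_(size S, n.+1) := \matrix_(i, j) evalp (S`_i)^`M(j) v.

Definition nonsingular_curve n (S : seq {mpoly k[n.+1]}) : Prop :=
  {in zeros S, forall P, (n.-1 <= \rank (jacobian S (coords P)))%N}.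

End Varieties.

(** * The curve C_abcd

  The map (x, y) |-> [x^3 : x^2 : x : 1 : xy], with inverse
  u |-> (u_2 / u_3, u_4 / u_2), embeds the quasi-affine curve
  y^2 + y = a x^3 + b x + c/x + d, x != 0, into P^4.  With v = xy the equation
  becomes v^2 + x v = a x^5 + b x^3 + c x + d x^2, and the closure of the image
  is cut out by the quadrics below (the cone over the twisted cubic, and one
  more quadric).  It adds one point over x = 0 and one over x = oo (curveP),
  and the result is nonsingular (nonsingular_curve_eqs), so it is the smooth
  projective model.  The embedding is the tricanonical one: the curve has genus
  2 and degree 6. *)

Section Curve.
Variable k : fieldType.

Definition curve_eqs (a b c d : k) : seq {mpoly k[5]} :=
  let u (j : nat) : {mpoly k[5]} := 'X_(inord j) in
  let: (u0, u1, u2, u3, u4) := (u 0%N, u 1%N, u 2%N, u 3%N, u 4%N) in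
  [:: u0 * u2 - u1 ^+ 2;
      u0 * u3 - u1 * u2;
      u1 * u3 - u2 ^+ 2;
      u4 ^+ 2 + u2 * u4 - (a *: (u0 * u1) + b *: (u0 * u3)
                           + c *: (u2 * u3) + d *: (u1 * u3))].

Variables (K : fieldType) (f : {rmorphism k -> K}).

Definition curve (a b c d : k) : pred (projpt K 4) :=
  zeros f (curve_eqs a b c d).

Definition row5 (x0 x1 x2 x3 x4 : K) : 'rV[K]_5 :=
  \row_(j < 5) [:: x0; x1; x2; x3; x4]`_j.

Definition affine_pt (x y : K) : projpt K 4 :=
  pt (row5 (x ^+ 3) (x ^+ 2) x 1 (x * y)).
Definition pt_over_zero : projpt K 4 := pt (row5 0 0 0 1 0).
Definition pt_over_infty : projpt K 4 := pt (row5 1 0 0 0 0).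

(* The involution iota : (x, y) |-> (x, y + 1), in the coordinates of P^4
   (hyp_inv_affine): the linear map u_4 |-> u_4 + u_2. *)
Definition hyp_inv (P : projpt K 4) : projpt K 4 :=
  let u (j : nat) := coords P 0 (inord j) in
  pt (row5 (u 0%N) (u 1%N) (u 2%N) (u 3%N) (u 4%N + u 2%N)).

Let row5E x0 x1 x2 x3 x4 :
  ((row5 x0 x1 x2 x3 x4 0 (inord 0) = x0) *
   (row5 x0 x1 x2 x3 x4 0 (inord 1) = x1) *
   (row5 x0 x1 x2 x3 x4 0 (inord 2) = x2) *
   (row5 x0 x1 x2 x3 x4 0 (inord 3) = x3) *
   (row5 x0 x1 x2 x3 x4 0 (inord 4) = x4))%type.
Proof. by rewrite !mxE !inordK. Qed.

Let row5_coords (v : 'rV[K]_5) :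
  v = row5 (v 0 (inord 0)) (v 0 (inord 1)) (v 0 (inord 2)) (v 0 (inord 3))
           (v 0 (inord 4)).
Proof.
apply/rowP=> j; rewrite mxE -{1}(inord_val j).
by case: j => [[|[|[|[|[|j]]]]] hj].
Qed.

Let row5Z t x0 x1 x2 x3 x4 : t *: row5 x0 x1 x2 x3 x4 =
  row5 (t * x0) (t * x1) (t * x2) (t * x3) (t * x4).
Proof. by apply/rowP=> [[[|[|[|[|[|j]]]]] hj]]; rewrite !mxE. Qed.

Let row5_eq0 x0 x1 x2 x3 x4 : row5 x0 x1 x2 x3 x4 = 0 ->
  [/\ x0 = 0, x1 = 0, x2 = 0, x3 = 0 & x4 = 0].
Proof.
move=> E; have := row5E x0 x1 x2 x3 x4; rewrite E !mxE.
by move=> [[[[-> ->] ->] ->] ->].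
Qed.

Let affine_neq0 x y : row5 (x ^+ 3) (x ^+ 2) x 1 (x * y) != 0.
Proof. by apply/eqP=> /row5_eq0[_ _ _ /eqP]; rewrite oner_eq0. Qed.

Let zero_neq0 : row5 0 0 0 1 0 != 0.
Proof. by apply/eqP=> /row5_eq0[_ _ _ /eqP]; rewrite oner_eq0. Qed.

Let infty_neq0 : row5 1 0 0 0 0 != 0.
Proof. by apply/eqP=> /row5_eq0[/eqP]; rewrite oner_eq0. Qed.

Let evalp_eqs a b c d (v : 'rV[K]_5) :
  all (fun p => evalp f p v == 0) (curve_eqs a b c d) =
  let u (j : nat) := v 0 (inord j) in
  let: (u0, u1, u2, u3, u4) := (u 0%N, u 1%N, u 2%N, u 3%N, u 4%N) in
  [&& u0 * u2 == u1 ^+ 2, u0 * u3 == u1 * u2, u1 * u3 == u2 ^+ 2 &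
      u4 ^+ 2 + u2 * u4 == f a * (u0 * u1) + f b * (u0 * u3)
                           + f c * (u2 * u3) + f d * (u1 * u3)].
Proof.
rewrite /= andbT !expr2 !(evalpB, evalpD, evalpM, evalpZ, evalpX).
by rewrite !subr_eq0.
Qed.

Let in_curveE a b c d x0 x1 x2 x3 x4 : row5 x0 x1 x2 x3 x4 != 0 ->
  (pt (row5 x0 x1 x2 x3 x4) \in curve a b c d) =
  [&& x0 * x2 == x1 ^+ 2, x0 * x3 == x1 * x2, x1 * x3 == x2 ^+ 2 &
      x4 ^+ 2 + x2 * x4 == f a * (x0 * x1) + f b * (x0 * x3)
                           + f c * (x2 * x3) + f d * (x1 * x3)].
Proof.
move=> v0; have [t t0 Et] := coords_pt v0.
rewrite unfold_in /curve /zeros Et evalp_eqs /= row5Z !row5E.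
have sc p q p' q' : p' = t ^+ 2 * p -> q' = t ^+ 2 * q -> (p' == q') = (p == q).
  by move=> -> ->; rewrite (inj_eq (mulfI _)) // expf_neq0.
by congr [&& _, _, _ & _]; apply: sc; ring.
Qed.

Lemma curveP a b c d P :
  P \in curve a b c d <->
  [\/ P = pt_over_zero, P = pt_over_infty
    | exists x y, [/\ x != 0,
        y ^+ 2 + y = f a * x ^+ 3 + f b * x + f c / x + f d
      & P = affine_pt x y]].
Proof.
split=> [|[->|->|[x [y [x0 E ->]]]]]; last 3 first.
- rewrite in_curveE //; apply/and4P; split; apply/eqP; ring.
- rewrite in_curveE //; apply/and4P; split; apply/eqP; ring.
- rewrite in_curveE //; apply/and4P; split; apply/eqP; try ring.
  transitivity (x ^+ 2 * (y ^+ 2 + y)); first ring.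
  by rewrite E; field.
rewrite -{1}(coordsK P); have := coords_neq0 P.
have := coordsK P; rewrite (row5_coords (coords P)).
move: (coords P 0 (inord 0)) (coords P 0 (inord 1)) (coords P 0 (inord 2)).
move: (coords P 0 (inord 3)) (coords P 0 (inord 4)) => u3 u4 u0 u1 u2 EP v0.
rewrite in_curveE // => /and4P[/eqP h1 /eqP h2 /eqP h3 /eqP h4].
have [u20 | u2n0] := eqVneq u2 0.
  have u10 : u1 = 0 by apply/eqP; rewrite -sqrf_eq0 -h1 u20 mulr0.
  have u40 : u4 = 0.
    apply/eqP; rewrite -sqrf_eq0; apply/eqP.
    by move: h4; rewrite h2 u20 u10 !(mul0r, mulr0, addr0).
  move: h2 v0 EP; rewrite u10 u20 u40 mul0r => /eqP.
  rewrite mulf_eq0 => /orP[/eqP-> | /eqP->] v0 EP.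
    constructor 1; rewrite -EP; apply/pt_eq => //; exists u3.
      by apply: contraNneq v0 => ->; apply/eqP/rowP=> [[[|[|[|[|[|j]]]]] hj]];
         rewrite !mxE.
    by rewrite row5Z !mulr0 mulr1.
  constructor 2; rewrite -EP; apply/pt_eq => //; exists u0.
    by apply: contraNneq v0 => ->; apply/eqP/rowP=> [[[|[|[|[|[|j]]]]] hj]];
       rewrite !mxE.
  by rewrite row5Z !mulr0 mulr1.
have : u1 * u3 != 0 by rewrite h3 expf_neq0.
rewrite mulf_eq0 negb_or => /andP[u1n0 u3n0].
have e1 : u1 = u2 ^+ 2 / u3 by rewrite -h3 mulfK.
have e0 : u0 = u2 ^+ 3 / u3 ^+ 2.
  by apply: (mulIf u3n0); rewrite h2 e1; field.
constructor 3; exists (u2 / u3), (u4 / u2); split.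
- by rewrite mulf_neq0 // invr_eq0.
- have u4E : u4 ^+ 2 = - (u2 * u4) + (f a * (u0 * u1) + f b * (u0 * u3)
     + f c * (u2 * u3) + f d * (u1 * u3)) by rewrite -h4; ring.
  by rewrite expr_div_n u4E e0 e1; field; rewrite u2n0 u3n0.
- rewrite -EP; apply/pt_eq => //; exists u3 => //.
  by rewrite row5Z e0 e1; congr row5; field; rewrite ?u2n0 ?u3n0.
Qed.

Lemma hyp_inv_affine x y : hyp_inv (affine_pt x y) = affine_pt x (y + 1).
Proof.
rewrite /hyp_inv /=; have [t t0 ->] := coords_pt (affine_neq0 x y).
rewrite row5Z !row5E.
have E : row5 (t * x ^+ 3) (t * x ^+ 2) (t * x) (t * 1) (t * (x * y) + t * x) =
  t *: row5 (x ^+ 3) (x ^+ 2) x 1 (x * (y + 1)).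
  by rewrite row5Z; congr row5; ring.
rewrite E; apply/pt_eq => //; last by exists t.
by rewrite scaler_eq0 negb_or t0 affine_neq0.
Qed.

Lemma hyp_invK : 2%N \in [pchar k] -> involutive hyp_inv.
Proof.
move=> k2 P; have K2 := rmorph_pchar f k2.
have := coords_neq0 P; have := coordsK P.
rewrite {2}/hyp_inv /= (row5_coords (coords P)) !row5E.
move: (coords P 0 (inord 0)) (coords P 0 (inord 1)) (coords P 0 (inord 2)).
move: (coords P 0 (inord 3)) (coords P 0 (inord 4)) => u3 u4 u0 u1 u2 EP v0.
have w0 : row5 u0 u1 u2 u3 (u4 + u2) != 0.
  apply: contraNneq v0 => /row5_eq0[-> -> -> ->]; rewrite addr0 => ->.
  by apply/eqP/rowP=> [[[|[|[|[|[|j]]]]] hj]]; rewrite !mxE.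
rewrite /hyp_inv /=; have [t t0 ->] := coords_pt w0.
rewrite row5Z !row5E -{}EP.
have -> : t * (u4 + u2) + t * u2 = t * u4.
  by rewrite mulrDr -addrA (addrr_pchar2 K2) addr0.
by rewrite -row5Z; apply/pt_eq => //; [rewrite scaler_eq0 negb_or t0 | exists t].
Qed.

Let rank3 m n (A : 'M[K]_(m, n)) i0 i1 i2 j0 j1 j2 :
  A i0 j1 = 0 -> A i0 j2 = 0 -> A i1 j2 = 0 ->
  [&& A i0 j0 != 0, A i1 j1 != 0 & A i2 j2 != 0] -> (3 <= \rank A)%N.
Proof.
move=> z01 z02 z12 /and3P[n0 n1 n2].
pose g (i : 'I_3) := nth i0 [:: i0; i1; i2] i.
pose h (j : 'I_3) := nth j0 [:: j0; j1; j2] j.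
have U : mxsub g h A \in unitmx.
  rewrite unitmxE unitfE det_trig.
    by rewrite !big_ord_recl big_ord0 !mxE mulr1 !mulf_neq0.
  by apply/is_trig_mxP=> [[[|[|[|//]]] ?] [[|[|[|//]]] ?]] //; rewrite !mxE.
rewrite -(mxrank_unit U) -(mxrank_tr A).
have -> : mxsub g h A = rowsub g (rowsub h A^T)^T.
  by apply/matrixP=> i j; rewrite !mxE.
apply: leq_trans (mxrankS (rowsub_sub g _)) _.
by rewrite mxrank_tr; apply/mxrankS/rowsub_sub.
Qed.

Let dvar (v : 'rV[K]_5) i j : (i < 5)%N -> (j < 5)%N ->
  evalp f ('X_(inord i))^`M(inord j) v = (i == j)%:R.
Proof.
move=> hi hj; rewrite mderivX mnm1E -val_eqE /= !inordK //.
case: eqVneq => [->|_]; last by rewrite scale0r /evalp rmorph0 meval0.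
rewrite scale1r; have -> : (U_(inord j) - U_(inord j) = 0)%MM.
  by move=> n; apply/mnmP=> l; rewrite mnmBE subnn mnm0E.
by rewrite mpolyX0 /evalp rmorph1 meval1.
Qed.

Let jacE a b c d x0 x1 x2 x3 x4 (i : 'I_(size (curve_eqs a b c d))) j :
  (j < 5)%N ->
  jacobian f (curve_eqs a b c d) (row5 x0 x1 x2 x3 x4) i (inord j) =
  (nth [::] [:: [:: x2; - (x1 *+ 2); x0; 0; 0];
     [:: x3; - x2; - x1; x0; 0];
     [:: 0; x3; - (x2 *+ 2); x1; 0];
     [:: - (f a * x1 + f b * x3); - (f a * x0 + f d * x3); x4 - f c * x3;
         - (f b * x0 + f c * x2 + f d * x1); x4 *+ 2 + x2]] i)`_j.
Proof.
case: i j => [[|[|[|[|//]]]] hi] [|[|[|[|[|//]]]]] hj; rewrite mxE /=.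
all: rewrite ?expr2 !(mderivB, mderivD, mderivZ, mderivM).
all: rewrite !(evalpB, evalpD, evalpM, evalpZ, evalpX, dvar) // !row5E /=; ring.
Qed.

Lemma nonsingular_curve_eqs a b c d : 2%N \in [pchar k] -> a != 0 -> c != 0 ->
  nonsingular_curve f (curve_eqs a b c d).
Proof.
move=> k2 a0 c0 P; have K2 x : x *+ 2 = 0 :> K.
  by rewrite mulr2n (addrr_pchar2 (rmorph_pchar f k2)).
pose r i (hi : (i < 4)%N) : 'I_(size (curve_eqs a b c d)) :=
  @Ordinal (size (curve_eqs a b c d)) i hi.
case/curveP=> [->|->|[x [y [x0 E ->]]]].
- have [t t0 ->] := coords_pt zero_neq0; rewrite row5Z.
  apply: (@rank3 _ _ _ (r 2%N isT) (r 1%N isT) (r 3%N isT)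
                 (inord 1) (inord 0) (inord 2));
    rewrite !jacE //= ?(mulr0, mulr1, mul0rn, add0r, oppr0) //.
  by rewrite oppr_eq0 mulf_neq0 ?fmorph_eq0 ?t0.
- have [t t0 ->] := coords_pt infty_neq0; rewrite row5Z.
  apply: (@rank3 _ _ _ (r 0%N isT) (r 1%N isT) (r 3%N isT)
                 (inord 2) (inord 3) (inord 1));
    rewrite !jacE //= ?(mulr0, mulr1, mul0rn, addr0, oppr0) //.
  by rewrite oppr_eq0 mulf_neq0 ?fmorph_eq0 ?t0.
have [t t0 ->] := coords_pt (affine_neq0 x y); rewrite row5Z.
apply: (@rank3 _ _ _ (r 2%N isT) (r 1%N isT) (r 3%N isT)
               (inord 1) (inord 0) (inord 4));
  rewrite !jacE //= K2 ?oppr0 ?add0r //.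
by rewrite mulr1 t0 mulf_neq0.
Qed.

End Curve.

(* Main.v *)
(** Write C for the source, C' for the target, and (X, Y) for the pullbacks to
    the function field k(x, y) of C of the coordinates of C'.  On either curve
    dx and dx / x are regular everywhere: at infinity, with s = 1 / x and
    w = y / x^2, differentiating w^2 + s^2 w = a s + b s^3 + d s^4 + c s^5 gives
    dx = dw / (a + b s^2 + c s^4), and similarly over x = 0.  So dX and dX / X are
    regular on C, and bounding poles gives D X = al + be / x and
    D X / X = ga + de / x for the derivation D = d/dx.  As D X <> 0 (the morphism
    has an inverse, so x is a rational function of X and Y), X is a Moebius
    function of x.  Writing Y = A + B y, the equation of C' forces B^2 + B = 0 and
    A^2 + A = g'(X) + B g(x), where y^2 + y = g(x) and Y^2 + Y = g'(X); a pole of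
    A^2 + A has even order, and comparing orders leaves X = la x, B = 1 and A
    constant. *)
From HB Require Import structures.
Require Import Defs.
From mathcomp Require Import all_boot all_order all_algebra all_field.
From mathcomp Require Import mpoly ring zify.

Set Implicit Arguments.
Unset Strict Implicit.
Unset Printing Implicit Defensive.

Import GRing.Theory.
Local Open Scope ring_scope.

(** * Quadratic extensions of a ring *)

(** The obstacle is the passage between a morphism, which is given at points over K, and identities
    in the function field L. Each affine chart has a coordinate ring k[t][z] which embeds in L and
    is evaluated at the points over K. An element of it that vanishes at all points of the chart is
    zero, because its norm to k[t] has infinitely many roots. Hence a relation between homogeneous
    polynomials over k that holds pointwise holds in L, which produces (X, Y); conversely an
    identity in L can be evaluated at any point, which recovers the morphism from X and Y. The pole
    bound uses no divisors. The form dx / x has no zero at the points with x finite and dx has none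
    at infinity, so x D preserves the ring of the finite chart and D that of the chart at infinity.
    Regularity of dX and dX / X then bounds degrees of polynomials in x. The condition D X <> 0
    excludes constant and inseparable maps; it is where the inverse morphism is used. *)

(* S[z] / (z^2 + m z - n), an element u + v z being the pair (u, v). *)
Definition quad (S : comNzRingType) of S & S : Type := (S * S)%type.

Section Quad.
Variables (S : comNzRingType) (m n : S).
Local Notation Q := (quad m n).

HB.instance Definition _ := GRing.Zmodule.copy Q (S * S)%type.

Definition quad_one : Q := (1, 0).
Definition quad_mul (u v : Q) : Q :=
  (u.1 * v.1 + u.2 * v.2 * n, u.1 * v.2 + u.2 * v.1 - u.2 * v.2 * m).

Fact quad_mulA : associative quad_mul.
Proof. by move=> [a b] [c d] [e g]; congr pair; rewrite /=; ring. Qed.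

Fact quad_mulC : commutative quad_mul.
Proof. by move=> [a b] [c d]; congr pair; rewrite /=; ring. Qed.

Fact quad_mul1 : left_id quad_one quad_mul.
Proof. by move=> [a b]; congr pair; rewrite /=; ring. Qed.

Fact quad_mulD : left_distributive quad_mul +%R.
Proof. by move=> [a b] [c d] [e g]; congr pair; rewrite /=; ring. Qed.

Fact quad_oner_neq0 : quad_one != 0.
Proof. by apply/eqP => -[] /eqP; rewrite oner_eq0. Qed.

HB.instance Definition _ := GRing.Zmodule_isComNzRing.Build Q
  quad_mulA quad_mulC quad_mul1 quad_mulD quad_oner_neq0.

Definition quadC (a : S) : Q := (a, 0).
Definition quadZ : Q := (0, 1).

Fact quadC_zmod : zmod_morphism quadC.
Proof. by move=> a b; congr pair; rewrite /=; ring. Qed.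
HB.instance Definition _ := GRing.isZmodMorphism.Build S Q quadC quadC_zmod.
Fact quadC_monoid : monoid_morphism quadC.
Proof. by split=> // a b; congr pair; rewrite /=; ring. Qed.
HB.instance Definition _ := GRing.isMonoidMorphism.Build S Q quadC quadC_monoid.

Lemma quadE (u : Q) : u = quadC u.1 + quadC u.2 * quadZ.
Proof. by case: u => a b; congr pair; rewrite /=; ring. Qed.

Lemma quadZE : quadZ ^+ 2 + quadC m * quadZ = quadC n.
Proof. by rewrite expr2; congr pair; rewrite /=; ring. Qed.

(** The automorphism sending the root z to the other root -m - z. *)
Definition conj (u : Q) : Q := (u.1 - m * u.2, - u.2).
Definition norm (u : Q) : S := u.1 ^+ 2 - m * u.1 * u.2 - n * u.2 ^+ 2.

Lemma mul_conj u : u * conj u = quadC (norm u).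
Proof. by case: u => a b; congr pair; rewrite /norm /=; ring. Qed.

Lemma conj_eq0 u : (conj u == 0) = (u == 0).
Proof.
apply/eqP/eqP => [|->]; last by rewrite /conj /= mulr0 subr0 oppr0.
case: u => a b [] /= h /eqP; rewrite oppr_eq0 => /eqP b0.
by move: h; rewrite b0 mulr0 subr0 => ->.
Qed.

Section Map.
Variables (R : comNzRingType) (h : {rmorphism S -> R}) (z : R).
Hypothesis zE : z ^+ 2 + h m * z = h n.

Definition quad_map of z ^+ 2 + h m * z = h n :=
  fun u : Q => h u.1 + h u.2 * z.

Fact quad_map_zmod : zmod_morphism (quad_map zE).
Proof. by move=> [a b] [c d]; rewrite /quad_map /= !rmorphB; ring. Qed.
Fact quad_map_monoid : monoid_morphism (quad_map zE).
Proof.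
split=> [|[a b] [c d]]; first by rewrite /quad_map /= rmorph1 rmorph0; ring.
rewrite /quad_map /= !(rmorphB, rmorphD, rmorphM) -zE; ring.
Qed.
HB.instance Definition _ := GRing.isZmodMorphism.Build Q R
  (quad_map zE) quad_map_zmod.
HB.instance Definition _ := GRing.isMonoidMorphism.Build Q R
  (quad_map zE) quad_map_monoid.

Lemma quad_mapC a : quad_map zE (quadC a) = h a.
Proof. by rewrite /quad_map /= rmorph0 mul0r addr0. Qed.
Lemma quad_mapZ : quad_map zE quadZ = z.
Proof. by rewrite /quad_map /= rmorph0 rmorph1 mul1r add0r. Qed.
End Map.

End Quad.

Section QuadField.
Variables (F : fieldType) (m n : F).

(** Equivalently z^2 + m z - n has no root in F, so that the quadratic ring is a field. *)
Definition anisotropic := forall u : quad m n, norm u = 0 -> u = 0.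
Definition qfield of anisotropic : Type := quad m n.
Hypothesis ani : anisotropic.
HB.instance Definition _ := GRing.ComNzRing.copy (qfield ani) (quad m n).

Definition qinv (u : qfield ani) : qfield ani :=
  quadC m n (norm (u : quad m n))^-1 * conj u.

Fact qmulV u : u != 0 -> qinv u * u = 1.
Proof.
move=> u0; have Nu : norm (u : quad m n) != 0 by apply: contra_neq u0 => /ani.
rewrite /qinv -mulrA [X in _ * X]mulrC mul_conj.
by rewrite -(rmorphM (quadC m n)) mulVf // rmorph1.
Qed.
Fact qinv0 : qinv 0 = 0.
Proof.
by rewrite /qinv (eqP (_ : conj 0 == 0)) ?mulr0 // conj_eq0.
Qed.
HB.instance Definition _ := GRing.ComNzRing_isField.Build (qfield ani) qmulV qinv0.
End QuadField.

Local Notation "x %:F" := (@FracField.tofrac _ x) : ring_scope.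

(** * Rational functions and their derivative *)

(** The condition on the pair is boolean so that [xchoose] can select a representative. *)
Lemma frac_exists (R : idomainType) (z : {fraction R}) :
  exists p : R * R, (p.2 != 0) && (z == p.1%:F / p.2%:F).
Proof.
elim/quotW: z => r; exists (\n_r, \d_r); rewrite denom_ratioP /=.
have d0 : (\d_r)%:F != 0 by rewrite tofrac_eq0 denom_ratioP.
rewrite -(inj_eq (mulIf d0)) divfK //; unlock FracField.tofrac.
rewrite -[X in X == _]FracField.pi_mul FracField.equivf_def.
rewrite /FracField.mulf !numden_Ratio ?mulf_neq0 ?oner_eq0 ?denom_ratioP //.
by rewrite !mulr1 mulrC.
Qed.

Section QuotientRule.
Variables (F : fieldType) (P Q R S P' Q' R' S' : F).
Hypotheses (Q0 : Q != 0) (S0 : S != 0).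

(** Primes stand for derivatives: the second hypothesis is the derivative of the first, and
    eliminating R and R' shows that the quotient rule does not depend on the fraction chosen. *)
Lemma quotient_rule_unique : P * S = R * Q ->
  P' * S + P * S' = R' * Q + R * Q' ->
  (R' * S - R * S') / S ^+ 2 = (P' * Q - P * Q') / Q ^+ 2.
Proof.
move=> E E'; have ER : R = P * S / Q by rewrite E mulfK.
have ER' : R' = (P' * S + P * S' - R * Q') / Q by rewrite E' addrK mulfK.
by rewrite ER' ER; field; rewrite S0 Q0.
Qed.

Lemma quotient_rule_add :
  (((P' * S + P * S') + (R' * Q + R * Q')) * (Q * S)
    - (P * S + R * Q) * (Q' * S + Q * S')) / (Q * S) ^+ 2 =
  (P' * Q - P * Q') / Q ^+ 2 + (R' * S - R * S') / S ^+ 2.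
Proof. by field; rewrite S0 Q0. Qed.

Lemma quotient_rule_mul :
  ((P' * R + P * R') * (Q * S) - P * R * (Q' * S + Q * S')) / (Q * S) ^+ 2 =
  (P' * Q - P * Q') / Q ^+ 2 * (R / S) + P / Q * ((R' * S - R * S') / S ^+ 2).
Proof. by field; rewrite S0 Q0. Qed.
End QuotientRule.

Section RatDer.
Variables (k F : fieldType) (j : {rmorphism {poly k} -> F}).
Hypothesis j_inj : injective j.
Hypothesis j_frac :
  forall z : F, exists p : {poly k} * {poly k}, (p.2 != 0) && (z == j p.1 / j p.2).

Lemma j_eq0 p : (j p == 0) = (p == 0).
Proof. by rewrite -(inj_eq j_inj) rmorph0. Qed.

Definition numer z := (xchoose (j_frac z)).1.
Definition denom z := (xchoose (j_frac z)).2.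

Lemma denom_neq0 z : denom z != 0.
Proof. by have /andP[] := xchooseP (j_frac z). Qed.
Lemma numer_denom z : z = j (numer z) / j (denom z).
Proof. by have /andP[_ /eqP] := xchooseP (j_frac z). Qed.

Lemma frac_coprime z :
  exists p q : {poly k}, [/\ q != 0, coprimep p q & z = j p / j q].
Proof.
pose p := numer z; pose q := denom z; pose d := gcdp p q.
have q0 : q != 0 := denom_neq0 z.
have d0 : d != 0 by rewrite gcdp_eq0 negb_and q0 orbT.
have Ep : p = p %/ d * d by rewrite divpK // dvdp_gcdl.
have Eq : q = q %/ d * d by rewrite divpK // dvdp_gcdr.
have qd0 : q %/ d != 0 by apply: contra_neq q0 => E; rewrite Eq E mul0r.
exists (p %/ d), (q %/ d); split=> //.
  by apply: coprimep_div_gcd; rewrite q0 orbT.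
have dF : j d != 0 by rewrite j_eq0.
by rewrite {1}(numer_denom z) -/p -/q {1}Ep {1}Eq !rmorphM -mulf_div divff ?mulr1.
Qed.

(** The quotient rule on one selected fraction; [derF_frac] removes the dependence on the
    selection. *)
Definition derF (z : F) : F :=
  (j (numer z)^`() * j (denom z) - j (numer z) * j (denom z)^`())
    / j (denom z) ^+ 2.

Lemma derF_frac p q : q != 0 ->
  derF (j p / j q) = (j p^`() * j q - j p * j q^`()) / j q ^+ 2.
Proof.
move=> q0; set z : F := j p / j q.
have := numer_denom z; have := denom_neq0 z; rewrite /derF.
move: (numer z) (denom z) => r s s0 Ez.
have sF : j s != 0 by rewrite j_eq0.
have qF : j q != 0 by rewrite j_eq0.
have E : p * s = r * q.
  apply: j_inj; rewrite !rmorphM.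
  by move/eqP: Ez; rewrite /z (eqr_div _ _ qF sF) => /eqP.
apply: quotient_rule_unique => //; first by rewrite -!rmorphM E.
by rewrite -!rmorphM -!rmorphD -!derivM E.
Qed.

Lemma derFD : {morph derF : u v / u + v}.
Proof.
move=> u v; rewrite (numer_denom u) (numer_denom v).
have := denom_neq0 u; have := denom_neq0 v.
move: (numer u) (denom u) (numer v) (denom v) => p q r s s0 q0.
have sF : j s != 0 by rewrite j_eq0.
have qF : j q != 0 by rewrite j_eq0.
rewrite (addf_div _ _ qF sF) -!rmorphM -rmorphD !derF_frac ?mulf_neq0 //.
by rewrite derivD !derivM !(rmorphD, rmorphM) quotient_rule_add.
Qed.

Lemma derFM u v : derF (u * v) = derF u * v + u * derF v.
Proof.
rewrite {1 2 3}(numer_denom u) {1 2 3}(numer_denom v).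
have := denom_neq0 u; have := denom_neq0 v.
move: (numer u) (denom u) (numer v) (denom v) => p q r s s0 q0.
have sF : j s != 0 by rewrite j_eq0.
have qF : j q != 0 by rewrite j_eq0.
rewrite (mulf_div (j p)) -!rmorphM !derF_frac ?mulf_neq0 //.
by rewrite !derivM !(rmorphD, rmorphM) quotient_rule_mul.
Qed.

Lemma derF_poly p : derF (j p) = j p^`().
Proof.
rewrite -[in LHS](divr1 (j p)) -(rmorph1 j) derF_frac ?oner_eq0 //.
by rewrite -polyC1 derivC rmorph0 mulr0 subr0 rmorph1 mulr1 expr1n divr1.
Qed.
End RatDer.

(** * Derivations and local rings *)

Section MultiEval.
Variables (k : fieldType) (n : nat).

(** Naturality of evaluation. It transports the value of a polynomial from a chart ring to L or to
    K, and it computes values of composed polynomials. *)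
Lemma mmap_morph (S S' : comNzRingType) (h : {rmorphism k -> S})
    (g : {rmorphism S -> S'}) (h' : {rmorphism k -> S'}) v w
    (p : {mpoly k[n]}) :
  (forall c, g (h c) = h' c) -> (forall i, g (v i) = w i) ->
  g (mmap h v p) = mmap h' w p.
Proof.
move=> hE vE; rewrite /mmap rmorph_sum; apply: eq_bigr => m _.
rewrite rmorphM hE /mmap1 rmorph_prod; congr (_ * _).
by apply: eq_bigr => i _; rewrite rmorphXn /= vE.
Qed.

Lemma mmap_homog (S : comNzRingType) (h : {rmorphism k -> S}) v w t e
    (p : {mpoly k[n]}) : p \is e.-homog -> (forall i, w i = t * v i) ->
  mmap h w p = t ^+ e * mmap h v p.
Proof.
move=> /dhomogP p_e wE; rewrite /mmap mulr_sumr !big_seq.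
apply: eq_bigr => m /p_e /= <-; rewrite mulrCA; congr (_ * _).
rewrite /mmap1 mdegE -prodrXr -big_split /=.
by apply: eq_bigr => i _; rewrite wE exprMn.
Qed.
End MultiEval.

Definition derivation (L : comNzRingType) (D : L -> L) :=
  {morph D : u v / u + v} /\ forall u v, D (u * v) = D u * v + u * D v.

Section Derivation.
Variables (L : comNzRingType) (D : L -> L).
Hypothesis der : derivation D.

Lemma derD : {morph D : u v / u + v}. Proof. by case: der. Qed.
Lemma derM u v : D (u * v) = D u * v + u * D v. Proof. by case: der. Qed.
Lemma der0 : D 0 = 0.
Proof. by apply: (addrI (D 0)); rewrite -derD !addr0. Qed.
Lemma der1 : D 1 = 0.
Proof. by apply: (addrI (D 1)); rewrite addr0 -{3}(mulr1 1) derM mulr1 mul1r. Qed.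
Lemma derX0 u e : D u = 0 -> D (u ^+ e) = 0.
Proof.
move=> u0; elim: e => [|e IH]; first exact: der1.
by rewrite exprS derM u0 IH mul0r mulr0 addr0.
Qed.

Lemma der_scale c : derivation (fun u => c * D u).
Proof.
by split=> u v; [rewrite derD mulrDr | rewrite derM; ring].
Qed.

Lemma der_mmap (k : fieldType) n (h : {rmorphism k -> L}) v (p : {mpoly k[n]}) :
  (forall c : k, D (h c) = 0) -> (forall i, D (v i) = 0) -> D (mmap h v p) = 0.
Proof.
move=> h0 v0; rewrite /mmap (big_morph D derD der0) big1 // => m _.
rewrite derM h0 mul0r add0r /mmap1.
suff -> : D (\prod_(i < n) v i ^+ m i) = 0 by rewrite mulr0.
apply: (big_ind (fun u => D u = 0)); first exact: der1.
  by move=> u w u0 w0; rewrite derM u0 w0 mul0r mulr0 addr0.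
by move=> i _; apply: derX0.
Qed.
End Derivation.

Lemma derV (L : fieldType) (D : L -> L) u : derivation D -> u != 0 ->
  D u^-1 = - D u / u ^+ 2.
Proof.
move=> der u0; have := der1 der; rewrite -(divff u0) derM // => E.
have -> : D u^-1 = (D u / u + u * D u^-1) / u - D u / u ^+ 2 by field.
by rewrite E mul0r sub0r mulNr.
Qed.

Section Horner.
Variables (k : fieldType) (S : comNzRingType) (h : {rmorphism k -> S}) (t : S).
Definition hcomm : commr_rmorph h t := fun c => mulrC t (h c).
Definition hp : {rmorphism {poly k} -> S} := horner_morph hcomm.
Lemma hpC c : hp c%:P = h c. Proof. exact: horner_morphC. Qed.
Lemma hpX : hp 'X = t. Proof. exact: horner_morphX. Qed.
Lemma hpE p : hp p = (map_poly h p).[t]. Proof. by []. Qed.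

Lemma der_hp D : derivation D -> (forall c, D (h c) = 0) ->
  forall p, D (hp p) = hp p^`() * D t.
Proof.
move=> der h0; elim/poly_ind=> [|p c IH].
  by rewrite deriv0 !rmorph0 mul0r (der0 der).
rewrite derivD derivM derivX derivC !(rmorphD, rmorphM) hpC hpX rmorph1 rmorph0.
by rewrite (derD der) (derM der) IH h0; ring.
Qed.
End Horner.

Section LocalRing.
Variables (T : comNzRingType) (L K : fieldType).
Variables (iota : {rmorphism T -> L}) (ev : {rmorphism T -> K}).
Hypothesis iota_inj : injective iota.

(* A point is encoded by the evaluation [ev] there of the coordinate ring T;
   [hasval h z] says that [h] is regular at that point, with value [z]. *)
Definition hasval (h : L) (z : K) :=
  exists P G, [/\ ev G != 0, iota G * h = iota P & ev P = z * ev G].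

Lemma hasval_iota P : hasval (iota P) (ev P).
Proof. by exists P, 1; rewrite !rmorph1 oner_neq0 mul1r mulr1. Qed.

Lemma hasvalD h z h' z' : hasval h z -> hasval h' z' -> hasval (h + h') (z + z').
Proof.
move=> [P [G [G0 E V]]] [P' [G' [G'0 E' V']]].
exists (P * G' + P' * G), (G * G'); rewrite !(rmorphD, rmorphM) mulf_neq0 //.
by split; rewrite // -?E -?E' ?V ?V'; ring.
Qed.

Lemma hasvalM h z h' z' : hasval h z -> hasval h' z' -> hasval (h * h') (z * z').
Proof.
move=> [P [G [G0 E V]]] [P' [G' [G'0 E' V']]].
exists (P * P'), (G * G'); rewrite !rmorphM mulf_neq0 //.
by split; rewrite // -?E -?E' ?V ?V'; ring.
Qed.

Lemma hasvalX h z e : hasval h z -> hasval (h ^+ e) (z ^+ e).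
Proof.
move=> hz; elim: e => [|e IH]; last by rewrite !exprS; apply: hasvalM.
by have := hasval_iota 1; rewrite !rmorph1.
Qed.

Lemma ev_iota0 P : ev P != 0 -> iota P != 0.
Proof.
by apply: contra_neq => P0; rewrite (iota_inj (etrans P0 (esym (rmorph0 iota)))) rmorph0.
Qed.

Lemma hasval_neq0 h z : z != 0 -> hasval h z -> h != 0.
Proof.
move=> z0 [P [G [G0 E V]]].
have P0 : ev P != 0 by rewrite V mulf_neq0.
by apply: contraTneq (ev_iota0 P0) => h0; rewrite -E h0 mulr0 eqxx.
Qed.

Lemma hasvalV h z : z != 0 -> hasval h z -> hasval h^-1 z^-1.
Proof.
move=> z0 hz; have h0 := hasval_neq0 z0 hz; case: hz => [P [G [G0 E V]]].
exists G, P; split; [by rewrite V mulf_neq0 | by rewrite -E mulfK |].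
by rewrite V mulKf.
Qed.

Lemma hasval_frac P G h : ev G != 0 -> iota G * h = iota P ->
  hasval h (ev P / ev G).
Proof. by move=> G0 E; exists P, G; rewrite divfK. Qed.

Definition regular h := exists z, hasval h z.

Lemma regularM h h' : regular h -> regular h' -> regular (h * h').
Proof. by move=> [z ?] [z' ?]; exists (z * z'); apply: hasvalM. Qed.

(** If G h = P, then G^2 D h = P' G - P G', and G^2 is nonzero wherever G is. *)
Lemma regular_der D : derivation D ->
  (forall P, exists P', D (iota P) = iota P') ->
  forall h, regular h -> regular (D h).
Proof.
move=> der DT h [z [P [G [G0 E _]]]].
have [P' EP] := DT P; have [G' EG] := DT G.
have : iota (G * G) * D h = iota (P' * G - P * G').
  rewrite !(rmorphB, rmorphM) -EP -EG -E (derM der); ring.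
move=> {}E; exists (ev (P' * G - P * G') / ev (G * G)).
by apply: hasval_frac; rewrite // rmorphM mulf_neq0.
Qed.
End LocalRing.

(** * Poles of A^2 + A *)

Section ArtinSchreierPoles.
Variables (k : fieldType) (n m T U : {poly k}).

(** With A = n / m in lowest terms, A^2 + A = n (n + m) / m^2 = U / (('X - r)^e T). A root r of m is
    a root of neither n nor n + m, so e is twice its multiplicity in m; if r is not a root of m,
    then e = 0. *)
Lemma as_pole_even r e : coprimep n m -> ~~ root T r -> ~~ root U r ->
  n * (n + m) * (('X - r%:P) ^+ e * T) = m ^+ 2 * U -> ~~ odd e.
Proof.
move=> co Tr Ur E.
have U0 : U != 0 by apply: contraNneq Ur => ->; rewrite root0.
have T0 : T != 0 by apply: contraNneq Tr => ->; rewrite root0.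
have X0 : ('X - r%:P) ^+ e != 0 by rewrite expf_neq0 // polyXsubC_eq0.
have m0 : m != 0.
  apply/eqP=> m0; move/eqP: E; rewrite m0 addr0 expr0n mul0r !mulf_eq0.
  rewrite (negPf X0) (negPf T0) !orbF orbb => /eqP n0.
  by move: co; rewrite n0 m0 coprimep0 -size_poly_eq1 size_poly0.
have nn0 : n * (n + m) != 0.
  by apply: contraTneq (mulf_neq0 (expf_neq0 2 m0) U0) => n0; rewrite -E n0 mul0r eqxx.
have /(congr1 (mup r)) := E.
rewrite (mupM _ nn0 (mulf_neq0 X0 T0)) (mupMl _ Tr) (mupMl _ Ur) mup_XsubCX eqxx.
rewrite expr2 (mupM _ m0 m0).
have [mr | mr] := boolP (root m r); last first.
  by rewrite (mupNroot mr) => /eqP; rewrite addn_eq0 => /andP[_ /eqP->].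
have nr : ~~ root n r.
  by apply/negP=> nr; have := coprimep_root co nr; rewrite (eqP mr) eqxx.
have nmr : ~~ root (n + m) r by rewrite rootE hornerD (eqP mr) addr0.
by rewrite (mupMl _ nmr) (mupNroot nr) add0n addnn => ->; rewrite odd_double.
Qed.

(** The same at infinity: A^2 + A has positive degree deg U - deg T, so deg n > deg m and that
    degree is 2 (deg n - deg m). The sum of the sizes has the same parity. *)
Lemma as_degree_even : m != 0 -> T != 0 ->
  n * (n + m) * T = m ^+ 2 * U -> (size T < size U)%N ->
  ~~ odd (size U + size T).
Proof.
move=> m0 T0 E TU; have U0 : U != 0 by rewrite -size_poly_gt0; lia.
have R0 := mulf_neq0 (expf_neq0 2 m0) U0.
move: (R0); rewrite -E !mulf_eq0 !negb_or -andbA => /and3P[n0 nm0 _].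
have := congr1 (fun p : {poly k} => size p) E.
rewrite expr2 !size_mul ?mulf_neq0 //.
have sn : (0 < size n)%N by rewrite size_poly_gt0.
have sm : (0 < size m)%N by rewrite size_poly_gt0.
have sT : (0 < size T)%N by rewrite size_poly_gt0.
have snm : (0 < size (n + m)%R)%N by rewrite size_poly_gt0.
have [le_nm | lt_mn] := leqP (size n) (size m).
  have : (size (n + m)%R <= size m)%N.
    by rewrite (leq_trans (size_polyD _ _)) // geq_max le_nm leqnn.
  move: TU sn sm sT snm le_nm.
  move: (size n) (size m) (size (n + m)) (size T) (size U) => *; lia.
rewrite (size_polyDl lt_mn); move: TU sn sm sT lt_mn.
move: (size n) (size m) (size T) (size U) => *; lia.
Qed.

End ArtinSchreierPoles.

(* Evaluation at 1/x, cleared of denominators. *)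
Lemma hp_inv_reverse (k : fieldType) (L : fieldType) (h : {rmorphism k -> L})
    (x : L) (p : {poly k}) (N : nat) : x != 0 -> (size p <= N.+1)%N ->
  exists q : {poly k}, [/\ hp h x q = x ^+ N * hp h x^-1 p,
    (size q <= N.+1)%N & forall i, (i <= N)%N -> q`_i = p`_(N - i)].
Proof.
move=> x0 pN; exists (\poly_(i < N.+1) p`_(N - i)); split; last 2 first.
- exact: size_poly.
- by move=> i iN; rewrite coef_poly ltnS iN.
rewrite !hpE !(@horner_coef_wide _ N.+1) ?size_map_poly ?size_poly //.
rewrite mulr_sumr (reindex_inj rev_ord_inj) /=; apply: eq_bigr => i _.
have iN : (i <= N)%N by rewrite -ltnS.
rewrite subSS !coef_map /= coef_poly ltnS leq_subr subKn // mulrCA; congr (_ * _).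
by rewrite exprVn expfB_cond ?(negPf x0).
Qed.

(** * Affine charts *)

Section Chart.
Variables (k : fieldType) (m n : {poly k}).
Local Notation T := (quad m n).

Section Eval.
Variables (R : comNzRingType) (h : {rmorphism k -> R}) (t z : R).
(** The target ring is arbitrary: K gives the points of the chart, L gives its generic point. *)
Definition on_chart := z ^+ 2 + hp h t m * z = hp h t n.
Hypothesis E : on_chart.
Definition chart : {rmorphism T -> R} := quad_map E.
Lemma chartE P : chart P = hp h t P.1 + hp h t P.2 * z. Proof. by []. Qed.
Lemma chartC p : chart (quadC m n p) = hp h t p. Proof. exact: quad_mapC. Qed.
Lemma chartX : chart (quadC m n 'X) = t. Proof. by rewrite chartC hpX. Qed.
Lemma chartZ : chart (quadZ m n) = z. Proof. exact: quad_mapZ. Qed.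
Definition chart_const : {rmorphism k -> T} := quadC m n \o polyC.
Lemma chart_constE c : chart (chart_const c) = h c.
Proof. by rewrite chartC hpC. Qed.
End Eval.

Lemma on_chart_conj (R : comNzRingType) (h : {rmorphism k -> R}) t z :
  on_chart h t z -> on_chart h t (- hp h t m - z).
Proof. by rewrite /on_chart => <-; ring. Qed.

Lemma chart_conj (R : comNzRingType) (h : {rmorphism k -> R}) t z
    (E : on_chart h t z) P :
  chart E (conj P) = chart (on_chart_conj E) P.
Proof. by rewrite !chartE /= rmorphB rmorphN rmorphM /=; ring. Qed.

Lemma chart_der (L : comNzRingType) (h : {rmorphism k -> L}) t z
    (E : on_chart h t z) D t' z' : derivation D -> (forall c, D (h c) = 0) ->
  D t = chart E t' -> D z = chart E z' ->
  forall P, exists P', D (chart E P) = chart E P'.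
Proof.
move=> der D0 Dt Dz P.
exists (quadC m n P.1^`() * t' + quadC m n P.2^`() * t' * quadZ m n
        + quadC m n P.2 * z').
rewrite !(rmorphD, rmorphM) !chartC chartZ -Dt -Dz chartE.
by rewrite (derD der) (derM der) !(der_hp _ der D0); ring.
Qed.

Section Regular.
Variables (L : fieldType) (hL : {rmorphism k -> L}) (t z : L).
Hypothesis E : on_chart hL t z.
Hypothesis chart_inj : injective (chart E).
Variables (K : closedFieldType) (f : {rmorphism k -> K}).

(** The chart ring embeds in the field L, so one of the two factors of P * conj P = 0 is zero. *)
Lemma norm_eq0 (P : T) : norm P = 0 -> P = 0.
Proof.
move=> N0; have := congr1 (chart E) (mul_conj P).
rewrite N0 !rmorph0 rmorphM => /eqP; rewrite mulf_eq0.
case/orP=> /eqP E0; first by apply: chart_inj; rewrite E0 rmorph0.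
by apply/eqP; rewrite -conj_eq0; apply/eqP/chart_inj; rewrite E0 rmorph0.
Qed.

Lemma chart_point q : exists s, on_chart f q s.
Proof.
have [s Es] := @solve_monicpoly K 2 (nth 0 [:: hp f q n; - hp f q m]) isT.
exists s; rewrite /on_chart Es !big_ord_recl big_ord0 /= expr0 expr1; ring.
Qed.

(** If P were nonzero, its norm would be a nonzero polynomial in t, with a nonroot q in K. Some
    point of the chart lies over q, and P cannot vanish there since it divides its norm. *)
Lemma zero_test (P : T) :
  (forall q s (Eq : on_chart f q s), chart Eq P = 0) -> P = 0.
Proof.
move=> P0; apply: norm_eq0; apply/eqP/negPn/negP.
rewrite -(map_poly_eq0 f) => /closed_nonrootP[q].
have [s Eq] := chart_point q.
rewrite rootE -hpE -(chartC Eq) -mul_conj rmorphM P0 mul0r eqxx //.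
Qed.

(** Regularity at both points over q gives a denominator G that is nonzero at both; multiplying by
    its conjugate replaces it by its norm, a polynomial in t that is nonzero at q. *)
Lemma denominator_at q s (Eq : on_chart f q s) h :
  regular (chart E) (chart Eq) h ->
  regular (chart E) (chart (on_chart_conj Eq)) h ->
  exists C P, hp f q C != 0 /\ hp hL t C * h = chart E P.
Proof.
move=> [_ [P1 [G1 [G10 EP1 _]]]] [_ [P2 [G2 [G20 EP2 _]]]].
suff [P [G [G0 G0' EP]]] : exists P G, [/\ chart Eq G != 0,
    chart (on_chart_conj Eq) G != 0 & chart E G * h = chart E P].
  exists (norm G), (P * conj G); split.
    by rewrite -(chartC Eq) -mul_conj rmorphM chart_conj mulf_neq0.
  by rewrite -(chartC E) -mul_conj !rmorphM mulrAC EP.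
(* If each of G1 and G2 vanishes at the point where the other does not, then G1 + G2 vanishes at
   neither. *)
have [Z1 | N1] := eqVneq (chart (on_chart_conj Eq) G1) 0; last by exists P1, G1.
have [Z2 | N2] := eqVneq (chart Eq G2) 0; last by exists P2, G2.
exists (P1 + P2), (G1 + G2); rewrite !rmorphD Z1 Z2 addr0 add0r.
by split; rewrite // mulrDl EP1 EP2.
Qed.

(** The polynomials C in t with C h in the chart ring form an ideal of k[t]. By [denominator_at] no
    q in K is a common root, so a nonconstant C can be replaced by its gcd with a denominator that
    does not vanish at a root of C. *)
Lemma regular_chart h :
  (forall q s (Eq : on_chart f q s), regular (chart E) (chart Eq) h) ->
  exists P, h = chart E P.
Proof.
move=> reg.
have den q : exists C P, hp f q C != 0 /\ hp hL t C * h = chart E P.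
  by have [s Eq] := chart_point q; apply: denominator_at (reg _ _ Eq) (reg _ _ _).
have [C [P [C0 EP]]] := den 0.
have {}C0 : C != 0 by apply: contraNneq C0 => ->; rewrite rmorph0.
have [N] := ubnP (size C); elim: N C C0 P EP => // N IH C C0 P EP.
rewrite ltnS => CN.
have [C1 | C1] := leqP (size C) 1.
  have [c Ec] : exists c : k, C = c%:P /\ c != 0.
    by exists C`_0; have Ec := size1_polyC C1; rewrite -polyC_eq0 -Ec.
  exists (chart_const c^-1 * P); rewrite rmorphM /= chart_constE -EP Ec.1 hpC.
  by rewrite mulrA -rmorphM mulVf ?rmorph1 ?mul1r // Ec.2.
have /closed_rootP[q rq] : size (map_poly f C) != 1 by rewrite size_map_poly; lia.
have [C' [P' [C'q EP']]] := den q.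
have [u eq_gcd] := Bezoutp C C'.
pose C2 := u.1 * C + u.2 * C'.
have C2C : C2 %| C by rewrite (eqp_dvdl _ eq_gcd) dvdp_gcdl.
have C2C' : C2 %| C' by rewrite (eqp_dvdl _ eq_gcd) dvdp_gcdr.
have C20 : C2 != 0 by apply: contraNneq C0 => E0; rewrite -dvd0p -E0.
apply: (IH C2 C20 (quadC m n u.1 * P + quadC m n u.2 * P')).
  rewrite !(rmorphD, rmorphM) !chartC -EP -EP'; ring.
apply: leq_trans CN; rewrite ltn_neqAle dvdp_leq // andbT.
(* Without a drop in size the gcd would be C itself, so C would divide C' and q would be a root of
   C'. *)
apply: contraNneq C'q => sz; rewrite hpE -rootE.
have CC' : C %| C'.
  have : C2 %= C by rewrite -dvdp_size_eqp // sz.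
  by move/eqp_dvdl <-.
by apply: root_dvdp rq; rewrite dvdp_map.
Qed.
End Regular.
End Chart.

Definition vec5 (S : Type) (x0 x1 x2 x3 x4 : S) : 'I_5 -> S :=
  fun i => nth x0 [:: x0; x1; x2; x3; x4] i.

Lemma ord5P (P : 'I_5 -> Prop) :
  P (inord 0) -> P (inord 1) -> P (inord 2) -> P (inord 3) -> P (inord 4) ->
  forall i, P i.
Proof.
move=> h0 h1 h2 h3 h4 i; rewrite -(inord_val i).
by case: i => [[|[|[|[|[|]]]]]].
Qed.

Lemma vec5E (S : Type) (x0 x1 x2 x3 x4 : S) :
  ((vec5 x0 x1 x2 x3 x4 (inord 0) = x0) *
   (vec5 x0 x1 x2 x3 x4 (inord 1) = x1) *
   (vec5 x0 x1 x2 x3 x4 (inord 2) = x2) *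
   (vec5 x0 x1 x2 x3 x4 (inord 3) = x3) *
   (vec5 x0 x1 x2 x3 x4 (inord 4) = x4))%type.
Proof. by rewrite /vec5 !inordK. Qed.

(* The homogeneous coordinates of (x, y) in the tricanonical embedding. *)
Definition tricanonical (S : comNzRingType) (x y : S) : 'I_5 -> S :=
  vec5 (x ^+ 3) (x ^+ 2) x 1 (x * y).

Section Char2.
Variables (R : comNzRingType).
Hypothesis R2 : 2 = 0 :> R.
Lemma opp2 (u : R) : - u = u.
Proof. by rewrite -[LHS]addr0 -(mul0r u) -R2; ring. Qed.
Lemma addK2 (u v : R) : u + v + v = u. Proof. by ring: R2. Qed.
Lemma add_eq0_2 (u v : R) : u + v = 0 -> u = v.
Proof. by move=> E; rewrite -[LHS](addK2 u v) E add0r. Qed.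
End Char2.

(** * Regular differentials *)

(* The regular differentials of the target: dX and dX/X are regular wherever (X, Y) comes
   from a morphism to the curve. *)
Section LocalDifferentials.
Variables (k : fieldType) (T : comNzRingType) (L K : fieldType).
Variables (iota : {rmorphism T -> L}) (ev : {rmorphism T -> K}).
Hypothesis iota_inj : injective iota.
Hypothesis L2 : 2 = 0 :> L.
Variables (hT : {rmorphism k -> T}) (hL : {rmorphism k -> L}) (f : {rmorphism k -> K}).
Hypothesis iota_hT : forall e, iota (hT e) = hL e.
Hypothesis ev_hT : forall e, ev (hT e) = f e.
Variables (D : L -> L).
Hypotheses (der : derivation D) (D_hL : forall e, D (hL e) = 0).
Hypothesis DT : forall P, exists P', D (iota P) = iota P'.
Variables (a b c d : k) (X Y : L).
Hypotheses (a0 : a != 0) (c0 : c != 0) (X0 : X != 0).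
Hypothesis XY : Y ^+ 2 + Y = hL a * X ^+ 3 + hL b * X + hL c / X + hL d.
Variables (P : 'I_5 -> T) (tau : L).
Hypothesis PE : forall i, iota (P i) = tau * tricanonical X Y i.
Hypothesis evP : exists i, ev (P i) != 0.

Local Notation reg := (regular iota ev).
Local Notation val := (hasval iota ev).

Lemma val_const e : val (hL e) (f e).
Proof. by rewrite -iota_hT -ev_hT; apply: hasval_iota. Qed.

Lemma der_sq u : D (u ^+ 2) = 0.
Proof. by rewrite expr2 (derM der); ring: L2. Qed.

(** In characteristic 2 squares are killed by D, so the left side of the equation contributes only D
    Y. *)
Lemma derY : D Y = (hL a * X ^+ 2 + hL b + hL c / X ^+ 2) * D X.
Proof.
have : D (Y ^+ 2 + Y) = D Y by rewrite (derD der) der_sq add0r.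
rewrite XY (exprSr X 2) !(derD der, derM der, D_hL, derV der X0, der_sq).
by rewrite (opp2 L2) => <-; field.
Qed.

Let p i := P (inord i).
Let PE' : ((iota (p 0) = (tau * X ^+ 3)%R) * (iota (p 1) = (tau * X ^+ 2)%R) *
  (iota (p 2) = (tau * X)%R) * (iota (p 3) = tau) *
  (iota (p 4) = (tau * (X * Y))%R))%type.
Proof. by rewrite /p !PE /tricanonical !vec5E mulr1. Qed.

(** The relation holds in L, hence in T since [iota] is injective, and it survives evaluation. The
    next three lemmas argue in the same way. *)
Lemma ev_rel02 : ev (p 0) * ev (p 2) = ev (p 1) ^+ 2.
Proof.
by rewrite -rmorphM -rmorphXn; congr (ev _); apply: iota_inj;
   rewrite rmorphM rmorphXn !PE'; ring.
Qed.
Lemma ev_rel03 : ev (p 0) * ev (p 3) = ev (p 1) * ev (p 2).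
Proof.
by rewrite -!rmorphM; congr (ev _); apply: iota_inj; rewrite !rmorphM !PE'; ring.
Qed.
Lemma ev_rel13 : ev (p 1) * ev (p 3) = ev (p 2) ^+ 2.
Proof.
by rewrite -rmorphM -rmorphXn; congr (ev _); apply: iota_inj;
   rewrite rmorphM rmorphXn !PE'; ring.
Qed.
Lemma ev_rel4 : ev (p 4) ^+ 2 + ev (p 2) * ev (p 4) =
  f a * (ev (p 0) * ev (p 1)) + f b * (ev (p 0) * ev (p 3))
  + f c * (ev (p 2) * ev (p 3)) + f d * (ev (p 1) * ev (p 3)).
Proof.
rewrite -!ev_hT -!(rmorphM, rmorphXn, rmorphD); congr (ev _); apply: iota_inj.
rewrite !(rmorphM, rmorphXn, rmorphD) !PE' !iota_hT.
have -> : (tau * (X * Y)) ^+ 2 + tau * X * (tau * (X * Y)) =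
   tau ^+ 2 * X ^+ 2 * (Y ^+ 2 + Y) by ring.
by rewrite XY; field.
Qed.

(** If both coordinates vanished, the relations would kill the other three as well. So X or 1/X is
    finite at the image point. *)
Lemma ev03 : (ev (p 3) != 0) || (ev (p 0) != 0).
Proof.
have [p3|//] := eqVneq (ev (p 3)) 0; have [p0|//] := eqVneq (ev (p 0)) 0.
have [i] := evP; suff -> : ev (P i) = 0 by rewrite eqxx.
have p2 : ev (p 2) = 0.
  by apply/eqP; rewrite -sqrf_eq0 -ev_rel13 p3 mulr0.
have p1 : ev (p 1) = 0.
  by apply/eqP; rewrite -sqrf_eq0 -ev_rel02 p0 mul0r.
have p4 : ev (p 4) = 0.
  apply/eqP; rewrite -sqrf_eq0; apply/eqP; have := ev_rel4.
  by rewrite p0 p1 p2 !(mul0r, mulr0, addr0).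
by move: i; apply: ord5P.
Qed.

(** Here D is any derivation preserving the chart ring, so the lemma applies both to d/dx and to x
    d/dx. The cases are those of the image point: at infinity, over X <> 0, or over X = 0. *)
Lemma regular_dX : reg (D X) /\ reg (D X / X).
Proof.
have regD := regular_der der DT.
have [p3 | p3] := eqVneq (ev (p 3)) 0.
  have p2 : ev (p 2) = 0.
    by apply/eqP; rewrite -sqrf_eq0 -ev_rel13 p3 mulr0.
  have p1 : ev (p 1) = 0.
    by apply/eqP; rewrite -sqrf_eq0 -ev_rel02 p2 mulr0.
  have p0 : ev (p 0) != 0 by have := ev03; rewrite p3 eqxx.
  have vS : val X^-1 0.
    have := @hasval_frac _ _ _ iota ev (p 1) (p 0) X^-1 p0.
    by rewrite p1 mul0r; apply; rewrite !PE'; field.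
  have p4 : ev (p 4) = 0.
    apply/eqP; rewrite -sqrf_eq0; apply/eqP; have := ev_rel4.
    by rewrite p1 p2 p3 !(mul0r, mulr0, addr0).
  have vW : val (Y / X ^+ 2) 0.
    have := @hasval_frac _ _ _ iota ev (p 4) (p 0) (Y / X ^+ 2) p0.
    by rewrite p4 mul0r; apply; rewrite !PE'; field.
  pose e := hL a + hL b * X^-1 ^+ 2 + hL c * X^-1 ^+ 4.
  have ve : val e (f a).
    have -> : f a = f a + f b * 0 ^+ 2 + f c * 0 ^+ 4.
      by rewrite !expr0n /= !mulr0 !addr0.
    by do !apply: hasvalD; try apply: hasvalM; try apply: hasvalX;
       rewrite ?val_const //; apply: val_const.
  have fa0 : f a != 0 by rewrite fmorph_eq0.
  have e0 : e != 0 := hasval_neq0 iota_inj fa0 ve.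
  have EX : D X = D (Y / X ^+ 2) / e.
    apply: (mulIf e0); rewrite divfK // (derM der) -exprVn der_sq derY /e.
    by field.
  have rX : reg (D X).
    rewrite EX; apply: regularM; first by apply: regD; exists 0.
    by exists (f a)^-1; apply: hasvalV.
  by split=> //; apply: regularM => //; exists 0.
have vX : val X (ev (p 2) / ev (p 3)).
  by apply: hasval_frac; rewrite // !PE'; ring.
have vV : val (X * Y) (ev (p 4) / ev (p 3)).
  by apply: hasval_frac; rewrite // !PE'; ring.
have rX : reg (D X) by apply: regD; eexists; apply: vX.
split=> //; have [p2 | p2] := eqVneq (ev (p 2)) 0; last first.
  apply: regularM => //; exists (ev (p 2) / ev (p 3))^-1; apply: hasvalV => //.
  by rewrite mulf_neq0 ?invr_eq0.
have p1 : ev (p 1) = 0.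
  have /eqP := ev_rel13; rewrite p2 expr0n mulf_eq0 (negPf p3) orbF.
  by move/eqP.
have p4 : ev (p 4) = 0.
  apply/eqP; rewrite -sqrf_eq0; apply/eqP; have := ev_rel4.
  have p0 : ev (p 0) = 0.
    have /eqP := ev_rel03; rewrite p2 mulr0 mulf_eq0 (negPf p3) orbF.
    by move/eqP.
  by rewrite p0 p1 p2 !(mul0r, mulr0, addr0).
rewrite p2 mul0r in vX; rewrite p4 mul0r in vV.
(* Chosen so that D (X Y) = e * (D X / X); at the point over X = 0 the functions X and X Y vanish,
   so e takes the value f c, which is nonzero. *)
pose e := X * Y + hL c + hL b * X ^+ 2 + hL a * X ^+ 4.
have ve : val e (f c).
  have -> : f c = 0 + f c + f b * 0 ^+ 2 + f a * 0 ^+ 4.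
    by rewrite !expr0n /= !mulr0 add0r !addr0.
  by do !apply: hasvalD; try apply: hasvalM; try apply: hasvalX;
     rewrite //; apply: val_const.
have fc0 : f c != 0 by rewrite fmorph_eq0.
have e0 : e != 0 := hasval_neq0 iota_inj fc0 ve.
have -> : D X / X = D (X * Y) / e.
  apply: (mulIf e0); rewrite divfK // (derM der) derY /e.
  by field.
apply: regularM; first by apply: regD; exists 0.
by exists (f c)^-1; apply: hasvalV.
Qed.
End LocalDifferentials.

(** * Moebius solutions of the Artin-Schreier equation *)

Lemma size2_root (k : fieldType) (p : {poly k}) : size p = 2 ->
  exists al r, al != 0 /\ p = al%:P * ('X - r%:P).
Proof.
move=> sp; exists p`_1, (- p`_0 / p`_1).
have p1 : p`_1 != 0.
  have : lead_coef p != 0 by rewrite lead_coef_eq0 -size_poly_eq0 sp.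
  by rewrite lead_coefE sp.
split=> //; apply/polyP=> i; rewrite coefCM coefB coefX coefC.
case: i => [|[|i]] /=.
- by rewrite sub0r mulNr opprK mulrCA divff // mulr1.
- by rewrite subr0 mulr1.
- by rewrite subr0 mulr0 nth_default ?sp.
Qed.

Lemma size2_const (k : fieldType) (p : {poly k}) : (size p <= 2)%N -> size p != 2 ->
  exists c, p = c%:P.
Proof.
by move=> p2 p2'; exists p`_0; apply: size1_polyC; lia.
Qed.

Section Quartic.
Variables (k : fieldType).
Hypothesis k2 : 2 = 0 :> k.
Variables (a1 b1 c1 d1 a2 b2 c2 d2 be : k) (n m p q : {poly k}).
Hypotheses (a20 : a2 != 0) (c20 : c2 != 0) (co : coprimep n m) (m0 : m != 0).
Hypotheses (p2 : (size p <= 2)%N) (q2 : (size q <= 2)%N) (q0 : q != 0).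
Hypothesis npq : forall e : k, p != e%:P * q.
Hypothesis be01 : be = 0 \/ be = 1.
(** With X = p / q, the quotient of [num] by p q^3 is g'(X) and that of [num1] by 'X is g(x).
    Hypothesis [E] is thus A^2 + A = g'(X) + be g(x) for A = n / m, multiplied by m^2 p q^3 'X. *)
Let num := a2%:P * p ^+ 4 + b2%:P * (p ^+ 2 * q ^+ 2) + c2%:P * q ^+ 4
  + d2%:P * (p * q ^+ 3).
Let num1 := a1%:P * 'X ^+ 4 + b1%:P * 'X ^+ 2 + d1%:P * 'X + c1%:P.
Hypothesis E : n * (n + m) * (p * q ^+ 3 * 'X) =
  m ^+ 2 * ('X * num + be%:P * num1 * (p * q ^+ 3)).

(** Polynomials of degree at most one with a common root are proportional, which [npq] excludes. *)
Lemma not_both_roots r : root q r -> ~~ root p r.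
Proof.
move=> qr; apply/negP=> pr.
have sq : size q = 2.
  have [//|/(size2_const q2)[e Eq]] := eqVneq (size q) 2.
  by move: qr q0; rewrite Eq rootC polyC_eq0 => ->.
have [al [r' [al0 Eq]]] := size2_root sq.
have Er : r = r'.
  apply/eqP; move: qr; rewrite Eq rootE !hornerE mulf_eq0 (negPf al0) /=.
  by rewrite subr_eq0.
have [/size2_root [al' [r1 [al'0 Ep]]]|/(size2_const p2)[e Ep]] := eqVneq (size p) 2.
  have Er1 : r = r1.
    apply/eqP; move: pr; rewrite Ep rootE !hornerE mulf_eq0 (negPf al'0) /=.
    by rewrite subr_eq0.
  have := npq (al' / al); rewrite Ep Eq -Er1 -Er mulrA -rmorphM divfK //.
  by rewrite eqxx.
have := npq 0; rewrite mul0r Ep polyC_eq0; move: pr; rewrite Ep rootC => ->.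
by [].
Qed.

(** A root of q is a simple pole of X, hence a triple pole of g'(X). The only finite pole of g(x) is
    simple, at 0, and cannot cancel it, so A^2 + A would have a pole of odd order 3. *)
Lemma q_const : exists2 ga, ga != 0 & q = ga%:P.
Proof.
have [sq|/(size2_const q2)[e Eq]] := eqVneq (size q) 2; last first.
  by exists e => //; move: q0; rewrite Eq polyC_eq0.
have [ga [r [ga0 Eq]]] := size2_root sq; exfalso.
have qr : root q r by rewrite Eq rootM root_XsubC eqxx orbT.
have pr := not_both_roots qr.
have [r0 | r0] := eqVneq r 0; last first.
  have /(_ r 3) := @as_pole_even k n m (ga%:P ^+ 3 * p * 'X)
    ('X * num + be%:P * num1 * (p * q ^+ 3)) _ _ co.
  move=> /(_ _ _ _)/negP; apply=> //.
  - by rewrite !rootM !negb_or rootX r0 pr !andbT rootE !hornerE /= ga0. 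
  (* At a root of q only the term a2 p^4 of [num] survives. *)
  - by rewrite rootE /num /num1 !hornerE (eqP qr) /= !(mul0r, mulr0, addr0) !mulf_neq0.
  - rewrite -E Eq; ring.
rewrite {}r0 in Eq qr pr.
have Eq' : q = ga%:P * 'X by rewrite Eq subr0.
have /(_ 0 3) := @as_pole_even k n m (ga%:P ^+ 3 * p)
    (num + be%:P * num1 * (p * ga%:P ^+ 3 * 'X ^+ 2)) _ _ co.
move=> /(_ _ _ _)/negP; apply=> //.
- by rewrite rootM negb_or pr andbT rootE !hornerE /= !mulf_neq0.
- by rewrite rootE /num /num1 !hornerE (eqP qr) /= !(mul0r, mulr0, addr0) !mulf_neq0.
- apply: (mulIf (negbT (polyX_eq0 k))); rewrite subr0.
  transitivity (m ^+ 2 * ('X * num + be%:P * num1 * (p * q ^+ 3))); last first.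
    rewrite Eq'; ring.
  by rewrite -E Eq'; ring.
Qed.

Lemma quartic_descent : exists la r, [/\ la != 0, be = 1, p = la%:P * ('X * q),
  n = r%:P * m & [/\ a1 = la ^+ 3 * a2, b1 = la * b2, c1 = la^-1 * c2
    & r ^+ 2 + r = d1 + d2]].
Proof.
have [ga ga0 Eq] := q_const.
have [sp|/(size2_const p2)[e Ep]] := eqVneq (size p) 2; last first.
  by have := npq (e / ga); rewrite Ep Eq -rmorphM divfK // eqxx.
have [al [r [al0 Ep]]] := size2_root sp.
have pr : root p r by rewrite Ep rootM root_XsubC eqxx orbT.
(* A zero of X away from 0 would make c2 / X a simple pole of A^2 + A, every other term being finite
   there. *)
have [r0 | r0] := eqVneq r 0; last first.
  exfalso; have /(_ r 1%N) := @as_pole_even k n m (al%:P * ga%:P ^+ 3 * 'X)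
    ('X * num + be%:P * num1 * (p * q ^+ 3)) _ _ co.
  move=> /(_ _ _ _)/negP; apply=> //.
  - by rewrite !rootM !negb_or rootX r0 andbT !rootE !hornerE /= al0 ga0.
  - rewrite rootE /num /num1 !hornerE (eqP pr) /= !(mul0r, mulr0, addr0, add0r).
    by rewrite Eq hornerC !mulf_neq0.
  - rewrite -E Eq Ep; ring.
have {}Ep : p = al%:P * 'X by rewrite Ep r0 subr0.
pose la := al / ga.
have la0 : la != 0 by rewrite mulf_neq0 ?invr_eq0.
have Eal : al = la * ga by rewrite divfK.
(* The polynomial 'X * (g'(la x) + be g(x)). *)
pose U := (a2 * la ^+ 3 + be * a1)%:P * 'X ^+ 4 + (b2 * la + be * b1)%:P * 'X ^+ 2
  + (d2 + be * d1)%:P * 'X + (c2 / la + be * c1)%:P.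
have EU : n * (n + m) * 'X = m ^+ 2 * U.
  have c0 : (al * ga ^+ 3)%:P * 'X != 0 :> {poly k}.
    by rewrite mulf_neq0 ?polyX_eq0 // polyC_eq0 mulf_neq0 // expf_neq0.
  apply: (mulIf c0).
  transitivity (n * (n + m) * (p * q ^+ 3 * 'X)).
    by rewrite Ep Eq rmorphM rmorphXn /=; ring.
  rewrite E /num /num1 Ep Eq /U Eal.
  have -> : c2%:P = (c2 / la)%:P * la%:P :> {poly k} by rewrite -rmorphM divfK.
  rewrite !(rmorphD, rmorphM, rmorphXn) /=; ring.
(* A nonzero constant term of U would be a simple pole of A^2 + A at 0. Since c2 <> 0, its vanishing
   forces be = 1. *)
have cE : c2 / la + be * c1 = 0.
  apply/eqP/negPn/negP=> cn0.
  have /(_ 0 1%N) := @as_pole_even k n m 1 U _ _ co.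
  move=> /(_ _ _ _)/negP; apply=> //.
  - by rewrite rootC oner_neq0.
  - by rewrite rootE !hornerE /= !(mul0r, mulr0, addr0, add0r).
  - by rewrite subr0 mulr1.
have be1 : be = 1.
  case: be01 => // b0; move/eqP: cE; rewrite b0 mul0r addr0 mulf_eq0.
  by rewrite invr_eq0 (negPf c20) (negPf la0).
move: EU; rewrite /U cE be1 !mul1r; set e3 := a2 * _ + _; set e1 := b2 * _ + _.
set e0 := d2 + d1 => EU.
have {}EU : n * (n + m) * 1 = m ^+ 2 * (e3%:P * 'X ^+ 3 + e1%:P * 'X + e0%:P).
  by apply: (mulIf (negbT (polyX_eq0 k))); rewrite mulr1 EU rmorph0; ring.
have szC (e : k) : (size e%:P <= 1)%N by exact: size_polyC_leq1.
(* What remains is a polynomial with terms of degree 3, 1 and 0 only, and degrees 3 and 1 are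
   excluded by parity at infinity. *)
have e30 : e3 = 0.
  apply/eqP/negPn/negP=> e3n.
  have sU : size (e3%:P * 'X ^+ 3 + e1%:P * 'X + e0%:P) = 4.
    have s3 : size (e3%:P * 'X ^+ 3) = 4 by rewrite size_Cmul // size_polyXn.
    rewrite -addrA size_polyDl s3 //.
    apply: leq_ltn_trans (size_polyD _ _) _; rewrite gtn_max.
    rewrite !(leq_ltn_trans (szC _)) // andbT mul_polyC.
    by rewrite (leq_ltn_trans (size_scale_leq _ _)) // size_polyX.
  by have := as_degree_even m0 (oner_neq0 _) EU; rewrite sU size_poly1 => /(_ isT).
have e10 : e1 = 0.
  apply/eqP/negPn/negP=> e1n; move: EU; rewrite e30 mul0r add0r => EU.
  have sU : size (e1%:P * 'X + e0%:P) = 2.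
    by rewrite size_MXaddC polyC_eq0 (negPf e1n) /= size_polyC e1n.
  by have := as_degree_even m0 (oner_neq0 _) EU; rewrite sU size_poly1 => /(_ isT).
move: EU; rewrite e30 e10 !mul0r !add0r mulr1 => EU.
(* m divides n (n + m) = m^2 e0 and is prime to n, so it divides n + m, then n, then 1. *)
have sm : size m == 1.
  have cm : coprimep m n by rewrite coprimep_sym.
  rewrite -dvdp1 -(Gauss_dvdpr 1 cm) mulr1 -(dvdp_addl n (dvdpp m)).
  by rewrite -(Gauss_dvdpr _ cm) EU expr2 -mulrA dvdp_mulr.
have [v v0 mE] : exists2 v, v != 0 & m = v%:P by apply/size_poly1P.
have sn : (size n <= 1)%N.
  rewrite leqNgt; apply/negP=> n1.
  have snm : size (n + m) = size n by rewrite size_polyDl ?(eqP sm).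
  have n0 : n != 0 by rewrite -size_poly_gt0 ltnW.
  have nm0 : n + m != 0 by rewrite -size_poly_gt0 snm ltnW.
  have := congr1 (fun u : {poly k} => size u) EU.
  rewrite size_mul // snm mE -rmorphXn -rmorphM.
  move=> sE; have := size_polyC_leq1 (v ^+ 2 * e0); rewrite -sE.
  by move: (size n) n1; clear => s; lia.
have [w nE] : exists w, n = w%:P by exists n`_0; apply: size1_polyC.
have Ee : w ^+ 2 + w * v = v ^+ 2 * e0.
  move: EU; rewrite nE mE -!(rmorphM, rmorphD, rmorphXn) => /polyC_inj <-; ring.
exists la, (w / v); split=> //.
- by rewrite Ep Eq Eal rmorphM /=; ring.
- by rewrite nE mE -rmorphM divfK.
split.
- by rewrite mulrC; apply/esym/(add_eq0_2 k2); rewrite -[a1]mul1r -be1 -e30 be1 mul1r.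
- by rewrite mulrC; apply/esym/(add_eq0_2 k2); rewrite -e10.
- by rewrite mulrC; apply/esym/(add_eq0_2 k2); move: cE; rewrite be1 mul1r.
have -> : d1 + d2 = e0 by rewrite addrC.
apply: (mulfI (expf_neq0 2 v0)); rewrite -Ee; field.
exact: v0.
Qed.
End Quartic.

(** * The function field of the curve *)

(* The two affine charts v^2 + x v = ... (v = x y) and w^2 + s^2 w = ...
   (s = 1/x, w = y/x^2). *)
Section ChartEquations.
Variables (k : fieldType) (a b c d : k).
Definition m_zero : {poly k} := 'X.
Definition n_zero : {poly k} :=
  c%:P * 'X + d%:P * 'X ^+ 2 + b%:P * 'X ^+ 3 + a%:P * 'X ^+ 5.
Definition m_inf : {poly k} := 'X ^+ 2.
Definition n_inf : {poly k} :=
  a%:P * 'X + b%:P * 'X ^+ 3 + d%:P * 'X ^+ 4 + c%:P * 'X ^+ 5.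

Lemma hp_n_zero (R : comNzRingType) (h : {rmorphism k -> R}) t :
  hp h t n_zero = h c * t + h d * t ^+ 2 + h b * t ^+ 3 + h a * t ^+ 5.
Proof. by rewrite /n_zero !(rmorphXn, rmorphD, rmorphM) /= !hpC !hpX. Qed.
Lemma hp_n_inf (R : comNzRingType) (h : {rmorphism k -> R}) t :
  hp h t n_inf = h a * t + h b * t ^+ 3 + h d * t ^+ 4 + h c * t ^+ 5.
Proof. by rewrite /n_inf !(rmorphXn, rmorphD, rmorphM) /= !hpC !hpX. Qed.
Lemma hp_m_inf (R : comNzRingType) (h : {rmorphism k -> R}) t :
  hp h t m_inf = t ^+ 2.
Proof. by rewrite /m_inf rmorphXn /= hpX. Qed.
End ChartEquations.

Section FunctionField.
Variables (k F : fieldType) (j : {rmorphism {poly k} -> F}).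
Hypothesis j_inj : injective j.
Hypothesis j_frac :
  forall z : F, exists p : {poly k} * {poly k}, (p.2 != 0) && (z == j p.1 / j p.2).
Hypothesis k2 : 2 = 0 :> k.
Variables (L : fieldType) (J : {rmorphism F -> L}) (y : L) (a b c d : k).
(** F plays the role of k(x). L is known only through its properties: 1, y is a basis over F by
    [Lspan] and [Lfree], and D is d/dx. *)
Definition ff_const : {rmorphism k -> L} := J \o j \o polyC.
Local Notation hL := ff_const.
Definition ff_x : L := J (j 'X).
Local Notation x := ff_x.
Hypothesis c0 : c != 0.
Hypothesis yE : y ^+ 2 + y = hL a * x ^+ 3 + hL b * x + hL c / x + hL d.
Hypothesis Lspan : forall h, exists A B, h = J A + J B * y.
Hypothesis Lfree : forall A B, J A + J B * y = 0 -> A = 0 /\ B = 0.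
Variable D : L -> L.
Hypotheses (der : derivation D) (D_hL : forall e, D (hL e) = 0) (Dx : D x = 1).

Lemma ff_two : 2 = 0 :> L.
Proof. by rewrite -(rmorph0 hL) -k2 rmorphMn rmorph1. Qed.

Lemma ff_x_neq0 : x != 0.
Proof. by rewrite /x !fmorph_eq0 (j_eq0 j_inj) polyX_eq0. Qed.

Lemma hp_x p : hp hL x p = J (j p).
Proof.
elim/poly_ind: p => [|p e IH]; first by rewrite !rmorph0.
by rewrite !(rmorphD, rmorphM) /= IH hpX hpC.
Qed.

Lemma on_chart0 : on_chart (m_zero k) (n_zero a b c d) hL x (x * y).
Proof.
rewrite /on_chart hpX hp_n_zero; have X0 := ff_x_neq0.
transitivity (x ^+ 2 * (y ^+ 2 + y)); first by ring.
by rewrite yE; field.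
Qed.

Lemma on_chart_inf : on_chart (m_inf k) (n_inf a b c d) hL x^-1 (y / x ^+ 2).
Proof.
rewrite /on_chart hp_m_inf hp_n_inf; have X0 := ff_x_neq0.
transitivity ((y ^+ 2 + y) / x ^+ 4); first by field.
by rewrite yE; field.
Qed.

Local Notation iota0 := (chart on_chart0).
Local Notation iota_inf := (chart on_chart_inf).

Lemma iota0E P : iota0 P = J (j P.1) + J (j (P.2 * 'X)) * y.
Proof. by rewrite chartE !hp_x !rmorphM /= /x; ring. Qed.

Lemma iota0_inj : injective iota0.
Proof.
apply: raddf_inj => -[p q] /(etrans (esym (iota0E _)))/Lfree[/eqP + /eqP] /=.
rewrite !(j_eq0 j_inj) mulf_eq0 polyX_eq0 orbF /=.
by move=> /eqP-> /eqP->.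
Qed.

(** Multiplying by x^N turns polynomials in 1/x into polynomials in x with reversed coefficients, so
    that coordinates in the basis 1, y can be compared. *)
Lemma iota_inf_reverse (P : quad (m_inf k) (n_inf a b c d)) N :
  (size P.1 <= N.+1)%N -> (size P.2 <= N.+1)%N ->
  exists p q : {poly k}, [/\ x ^+ N * iota_inf P = J (j p) + J (j q) * y / x ^+ 2,
    (size p <= N.+1)%N, (size q <= N.+1)%N
    & forall i, (i <= N)%N -> p`_i = P.1`_(N - i) /\ q`_i = P.2`_(N - i)].
Proof.
move=> s1 s2; have [p [pE sp cp]] := hp_inv_reverse hL ff_x_neq0 s1.
have [q [qE sq cq]] := hp_inv_reverse hL ff_x_neq0 s2.
exists p, q; split=> // [|i iN]; last by rewrite cp ?cq.
by rewrite chartE -!hp_x pE qE; ring.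
Qed.

Lemma iota_inf_inj : injective iota_inf.
Proof.
apply: raddf_inj => P P0.
pose N := maxn (size P.1) (size P.2).
have s1 : (size P.1 <= N.+1)%N by rewrite ltnW // ltnS leq_maxl.
have s2 : (size P.2 <= N.+1)%N by rewrite ltnW // ltnS leq_maxr.
have [p [q [E _ _ pq]]] := iota_inf_reverse s1 s2.
have : J (j (p * 'X ^+ 2)) + J (j q) * y = 0.
  rewrite !(rmorphXn, rmorphM) -/x; have X0 := ff_x_neq0.
  transitivity (x ^+ 2 * (J (j p) + J (j q) * y / x ^+ 2)); first by field.
  by rewrite -E P0 !mulr0.
move/Lfree => [/eqP + /eqP]; rewrite !(j_eq0 j_inj) mulf_eq0 expf_eq0 polyX_eq0 orbF.
move=> /eqP p0 /eqP q0.
suff [E1 E2] : P.1 = 0 /\ P.2 = 0 by rewrite (surjective_pairing P) E1 E2.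
split; apply/polyP=> i; rewrite coef0; have [iN|Ni] := leqP i N.
- by have [+ _] := pq (N - i)%N (leq_subr _ _); rewrite subKn // p0 coef0 => <-.
- by rewrite nth_default // (leq_trans _ Ni) // leqW // leq_maxl.
- by have [_ +] := pq (N - i)%N (leq_subr _ _); rewrite subKn // q0 coef0 => <-.
- by rewrite nth_default // (leq_trans _ Ni) // leqW // leq_maxr.
Qed.

Lemma Dy : D y = hL a * x ^+ 2 + hL b + hL c / x ^+ 2.
Proof. by rewrite (derY ff_two der D_hL ff_x_neq0 yE) Dx mulr1. Qed.

(** D does not preserve the ring of the finite chart: D (x y) has a pole over x = 0. But x D (x y) =
    x y + a x^4 + b x^2 + c lies in it. At infinity D itself works, with D s = s^2 and D w = a + b
    s^2 + c s^4. *)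
Let xD u := x * D u.
Let xD_der : derivation xD := der_scale der x.

Lemma xD_iota0 P : exists P', xD (iota0 P) = iota0 P'.
Proof.
apply: (chart_der (t' := quadC _ _ 'X) (z' := quadZ _ _ +
  quadC _ _ (a%:P * 'X ^+ 4 + b%:P * 'X ^+ 2 + c%:P))) => //.
- by move=> e; rewrite /xD D_hL mulr0.
- by rewrite /xD Dx mulr1 chartX.
rewrite /xD (derM der) Dx Dy rmorphD chartZ chartC !(rmorphXn, rmorphD, rmorphM) /=.
by rewrite !hpC hpX; have X0 := ff_x_neq0; field.
Qed.

Lemma D_iota_inf P : exists P', D (iota_inf P) = iota_inf P'.
Proof.
have X0 := ff_x_neq0.
apply: (chart_der (t' := quadC _ _ ('X ^+ 2)) (z' :=
  quadC _ _ (a%:P + b%:P * 'X ^+ 2 + c%:P * 'X ^+ 4))) => //.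
- by rewrite (derV der X0) Dx (opp2 ff_two) chartC rmorphXn /= hpX; field.
rewrite chartC !(rmorphXn, rmorphD, rmorphM) /= !hpC hpX.
by rewrite -exprVn (derM der) (der_sq ff_two der) Dy; field.
Qed.

Section Core.
Variables (K : closedFieldType) (f : {rmorphism k -> K}).

Lemma on_chart_inf0 : on_chart (m_inf k) (n_inf a b c d) f 0 0.
Proof. by rewrite /on_chart hp_m_inf hp_n_inf; ring. Qed.

(** Near infinity h has a denominator in 1/x alone with nonzero constant term; reversed, it is a
    polynomial in x of degree exactly N. Comparing coordinates in the basis 1, y then kills the
    y-part of x h and bounds the degree of the rest by one. *)
Lemma regular_infinity h P : x * h = iota0 P ->
  regular iota_inf (chart on_chart_inf0) h ->
  exists p : {poly k}, (size p <= 2)%N /\ x * h = J (j p).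
Proof.
move=> hP reg.
(* The point at infinity is its own conjugate, since [m_inf] vanishes at 0. *)
have reg' : regular iota_inf (chart (on_chart_conj on_chart_inf0)) h.
  have evE Q : chart (on_chart_conj on_chart_inf0) Q = chart on_chart_inf0 Q.
    by rewrite !chartE hp_m_inf; ring.
  by case: reg => z [Q [G [G0 E V]]]; exists z, Q, G; rewrite !evE.
have [C [Q [C0 EQ]]] := denominator_at reg reg'.
have {}C0 : C`_0 != 0.
  move: C0; rewrite hpE horner_coef0 coef_map fmorph_eq0.
  exact.
pose N := maxn (size C) (maxn (size Q.1) (size Q.2)).
have sC : (size C <= N.+1)%N by rewrite ltnW // ltnS leq_maxl.
have s1 : (size Q.1 <= N.+1)%N by rewrite ltnW // ltnS /N maxnCA leq_maxl.
have s2 : (size Q.2 <= N.+1)%N by rewrite ltnW // ltnS /N maxnA leq_maxr.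
have [A [B [AB sA sB _]]] := iota_inf_reverse s1 s2.
have [Cr [CE sCr cCr]] := hp_inv_reverse hL ff_x_neq0 sC.
(* The top coefficient of the reversed polynomial is the constant term of C. *)
have {cCr}CrN : Cr`_N != 0 by rewrite cCr // subnn.
have szCr : size Cr = N.+1.
  by apply/eqP; rewrite eqn_leq sCr ltnNge; apply: contra CrN => sN; rewrite nth_default.
have Cr0 : Cr != 0 by rewrite -size_poly_gt0 szCr.
have E : J (j (Cr * P.1 - 'X * A)) + J (j ('X ^+ 2 * (Cr * P.2) - B)) * (y / x) = 0.
  rewrite !(rmorphB, rmorphXn, rmorphM) /= -/x.
  have X0 := ff_x_neq0.
  have E1 : J (j Cr) * (x * h) = x * (J (j A) + J (j B) * y / x ^+ 2).
    by rewrite -AB -hp_x CE -EQ; ring.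
  move: E1; rewrite hP iota0E !rmorphM /= -/x => E1.
  transitivity (J (j Cr) * (J (j P.1) + J (j P.2) * x * y)
                - x * (J (j A) + J (j B) * y / x ^+ 2)); first by field.
  by rewrite E1 subrr.
have {E} : J (j ('X * (Cr * P.1 - 'X * A))) + J (j ('X ^+ 2 * (Cr * P.2) - B)) * y = 0.
  have X0 := ff_x_neq0; rewrite [j ('X * _)]rmorphM rmorphM -/x.
  by rewrite -[RHS](mulr0 x) -E; field.
case/Lfree => /eqP + /eqP.
rewrite !(j_eq0 j_inj) mulf_eq0 polyX_eq0 /= !subr_eq0 => /eqP E1 /eqP E2.
(* Otherwise the left side of [E2] has size at least N + 3, while B has size at most N + 1. *)
have P20 : P.2 = 0.
  apply/eqP/negPn/negP=> P20; have := congr1 (fun u : {poly k} => size u) E2.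
  rewrite mulrC size_mulXn ?mulf_neq0 // size_mul // szCr.
  have : (0 < size P.2)%N by rewrite size_poly_gt0.
  by move: sB; move: (size B) (size P.2) => *; lia.
exists P.1; split; last by rewrite hP iota0E P20 mul0r !rmorph0 mul0r addr0.
have [->|P10] := eqVneq P.1 0; first by rewrite size_poly0.
have := congr1 (fun u : {poly k} => size u) E1.
rewrite size_mul // szCr.
have : (size ('X * A)%R <= N.+2)%N.
  have [->|A0] := eqVneq A 0; first by rewrite mulr0 size_poly0.
  by rewrite mulrC size_mulX.
by move: (size _) (size P.1) => *; lia.
Qed.

Variables (a2 b2 c2 d2 : k) (X Y : L).
Hypotheses (a20 : a2 != 0) (c20 : c2 != 0) (X0 : X != 0) (DX0 : D X != 0).
Hypothesis XY : Y ^+ 2 + Y = hL a2 * X ^+ 3 + hL b2 * X + hL c2 / X + hL d2.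
(** At the point [ev], the map (X, Y) to the target has homogeneous coordinates P in the chart ring,
    not all zero there; tau is the projective factor. *)
Definition represents (T : comNzRingType) (iota : T -> L) (ev : T -> K) :=
  exists P tau, (forall i, iota (P i) = tau * tricanonical X Y i) /\
    exists i : 'I_5, ev (P i) != 0.
Hypothesis rep0 : forall q s (Eq : on_chart (m_zero k) (n_zero a b c d) f q s),
  represents iota0 (chart Eq).
Hypothesis rep_inf : represents iota_inf (chart on_chart_inf0).

(** [regular_dX] is applied with x D at the finite points and with D at infinity. For h = D X and h
    = D X / X this puts x h in the finite chart ring and makes h regular at infinity. *)
Lemma fin_dX : (exists p : {poly k}, (size p <= 2)%N /\ x * D X = J (j p)) /\
  (exists q : {poly k}, (size q <= 2)%N /\ x * (D X / X) = J (j q)).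
Proof.
have [rP [rtau [rE rev]]] := rep_inf.
have [R1 R2] := regular_dX iota_inf_inj ff_two (chart_constE on_chart_inf)
  (chart_constE on_chart_inf0) der D_hL D_iota_inf a20 c20 X0 XY rE rev.
have fin q s (Eq : on_chart (m_zero k) (n_zero a b c d) f q s) :
    regular iota0 (chart Eq) (xD X) /\ regular iota0 (chart Eq) (xD X / X).
  have [P [tau [PE Pev]]] := rep0 Eq.
  have xD_hL e : xD (hL e) = 0 by rewrite /xD D_hL mulr0.
  exact: (regular_dX iota0_inj ff_two (chart_constE on_chart0)
    (chart_constE Eq) xD_der xD_hL xD_iota0 a20 c20 X0 XY PE Pev).
have [P EP] := regular_chart (fun q s Eq => (fin q s Eq).1).
have [Q EQ] := regular_chart (fun q s Eq => (fin q s Eq).2).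
split; first exact: regular_infinity EP R1.
by apply: (regular_infinity (P := Q)) R2; rewrite -EQ mulrA.
Qed.

Theorem function_field_map : exists la r : k, [/\ la != 0, X = hL la * x,
  Y = y + hL r & [/\ a = la ^+ 3 * a2, b = la * b2, c = la^-1 * c2
    & r ^+ 2 + r = d + d2]].
Proof.
have [[p [sp Ep]] [q [sq Eq]]] := fin_dX.
have x_n0 := ff_x_neq0.
have q0 : q != 0.
  apply: contraNneq DX0 => q0; move/eqP: Eq; rewrite q0 !rmorph0.
  by rewrite !mulf_eq0 (negPf x_n0) invr_eq0 (negPf X0) orbF.
have jq0 : j q != 0 by rewrite (j_eq0 j_inj).
have Jq0 : J (j q) != 0 by rewrite fmorph_eq0.
have EX : X = J (j p / j q).
  by rewrite fmorph_div -Ep -Eq; field; rewrite x_n0 X0 DX0.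
have [A [B EY]] := Lspan Y.
have jX0 : j 'X != 0 by rewrite (j_eq0 j_inj) polyX_eq0.
have jp0 : j p != 0 by apply: contraNneq X0 => p0; rewrite EX p0 mul0r rmorph0.
pose jc e := j e%:P.
have [G GE] : exists G, G = jc a * j 'X ^+ 3 + jc b * j 'X + jc c / j 'X + jc d.
  by eexists.
have [R RE] : exists R, R = jc a2 * (j p / j q) ^+ 3 + jc b2 * (j p / j q)
  + jc c2 / (j p / j q) + jc d2 by eexists.
have JG : y ^+ 2 + y = J G.
  by rewrite yE GE !rmorphD !(rmorphXn, fmorphV, rmorphM).
have JR : Y ^+ 2 + Y = J R.
  by rewrite XY EX RE !rmorphD !(rmorphXn, fmorphV, rmorphM).
(* Substituting y^2 = y + G writes Y^2 + Y - R in the basis 1, y. *)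
have : J (A ^+ 2 + A + B ^+ 2 * G - R) + J (B ^+ 2 + B) * y = 0.
  rewrite rmorphB (opp2 ff_two) -JR EY !(rmorphXn, rmorphD, rmorphM) /= -JG; ring: ff_two.
case/Lfree=> /eqP; rewrite subr_eq0 => /eqP EA EB.
have F2 : 2 = 0 :> F.
  by rewrite -(rmorph0 (j \o polyC)) -k2 rmorphMn rmorph1.
have Bbe : exists be : k, (be = 0 \/ be = 1) /\ B = jc be.
  have /eqP : B * (B + 1) = 0 by rewrite -EB; ring.
  rewrite mulf_eq0 => /orP[/eqP B0|/eqP B1].
    by exists 0; split; [left | rewrite B0 /jc !rmorph0].
  by exists 1; split; [right | rewrite /jc !rmorph1; apply: (add_eq0_2 F2)].
have [be [be01 EBe]] := Bbe.
have [n [m [m0 co EAnm]]] := frac_coprime j_inj j_frac A.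
have jm0 : j m != 0 by rewrite (j_eq0 j_inj).
(* Otherwise X would be a constant, which D kills. *)
have npq e : p != e%:P * q.
  apply: contraNneq DX0 => pe; rewrite EX pe (rmorphM j) mulfK //.
  by rewrite (D_hL e).
have E : n * (n + m) * (p * q ^+ 3 * 'X) = m ^+ 2 * ('X *
   (a2%:P * p ^+ 4 + b2%:P * (p ^+ 2 * q ^+ 2) + c2%:P * q ^+ 4 + d2%:P * (p * q ^+ 3))
   + be%:P * (a%:P * 'X ^+ 4 + b%:P * 'X ^+ 2 + d%:P * 'X + c%:P) * (p * q ^+ 3)).
  apply: j_inj; rewrite !(rmorphXn, rmorphD, rmorphM) /=.
  have E1 : j n * (j n + j m) = j m ^+ 2 * (A ^+ 2 + A) by rewrite EAnm; field.
  have E2 : A ^+ 2 + A = R + jc be ^+ 2 * G by rewrite -EBe -EA (addK2 F2).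
  have Ebe : jc be ^+ 2 = jc be.
    by case: be01 => ->; rewrite /jc ?rmorph0 ?rmorph1 ?expr0n ?expr1n.
  rewrite E1 E2 Ebe RE GE /jc.
  by field; rewrite jX0 jq0 jp0.
have [la [r [la0 be1 pE nE rel]]] :=
  quartic_descent k2 a20 c20 co m0 sp sq q0 npq be01 E.
exists la, r; split=> //.
  rewrite EX; have -> : j p / j q = j la%:P * j 'X by rewrite pE !(rmorphM j) mulrA mulfK.
  by rewrite rmorphM.
rewrite EY EBe be1 /jc !rmorph1 mul1r EAnm nE (rmorphM j) mulfK // addrC.
by [].
Qed.
End Core.
End FunctionField.

(** * Construction of the function field and of d/dx *)

Section Existence.
Variables (k F : fieldType) (j : {rmorphism {poly k} -> F}).
Hypothesis j_inj : injective j.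
Hypothesis j_frac :
  forall z : F, exists p : {poly k} * {poly k}, (p.2 != 0) && (z == j p.1 / j p.2).
Hypothesis k2 : 2 = 0 :> k.
Variables (a b c d : k).
Hypothesis c0 : c != 0.

Let F2 : 2 = 0 :> F.
Proof. by rewrite -(rmorph0 (j \o polyC)) -k2 rmorphMn rmorph1. Qed.

Definition as_rhs : F :=
  j a%:P * j 'X ^+ 3 + j b%:P * j 'X + j c%:P / j 'X + j d%:P.

(** A nontrivial zero (u, v) of the norm gives A = u / v in k(x) with A^2 + A = [as_rhs]. Since c <>
    0 the right side has a simple pole at 0, of odd order. *)
Lemma as_anisotropic : anisotropic 1 as_rhs.
Proof.
move=> [u v]; rewrite /norm /= mul1r => N0.
have jX0 : j 'X != 0 by rewrite (j_eq0 j_inj) polyX_eq0.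
have [v0 | v0] := eqVneq v 0.
  move: N0; rewrite v0 expr0n !mulr0 !subr0 => /eqP.
  by rewrite sqrf_eq0 => /eqP->.
exfalso; have [n [m [m0 co E]]] := frac_coprime j_inj j_frac (u / v).
have jm0 : j m != 0 by rewrite (j_eq0 j_inj).
have {}E : n * (n + m) * 'X =
    m ^+ 2 * (a%:P * 'X ^+ 4 + b%:P * 'X ^+ 2 + c%:P + d%:P * 'X).
  apply: j_inj; rewrite !(rmorphXn, rmorphD, rmorphM) /=.
  have Eu : u = v * (j n / j m) by rewrite -E mulrC divfK.
  have E1 : (j n / j m) ^+ 2 + j n / j m = as_rhs.
    apply: (mulfI (expf_neq0 2 v0)); apply: (add_eq0_2 F2).
    rewrite -[RHS]N0 Eu !(opp2 F2); ring.
  transitivity (j m ^+ 2 * ((j n / j m) ^+ 2 + j n / j m) * j 'X); first by field.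
  by rewrite E1 /as_rhs; field.
suff : ~~ odd 1 by [].
apply: (as_pole_even (r := 0) (T := 1) co) _ _ (_ : _ = m ^+ 2 * (_ + _)); last first.
- by rewrite subr0 mulr1; exact: E.
- by rewrite rootE !hornerE /= !(mul0r, mulr0, addr0, add0r).
- by rewrite rootE !hornerE oner_neq0.
Qed.

Definition as_field : fieldType := qfield as_anisotropic.
Definition as_emb_fun (A : F) : as_field := quadC 1 as_rhs A.
Fact as_emb_zmod : zmod_morphism as_emb_fun.
Proof. exact: (quadC_zmod (1 : F) as_rhs). Qed.
Fact as_emb_monoid : monoid_morphism as_emb_fun.
Proof. exact: (quadC_monoid (1 : F) as_rhs). Qed.
HB.instance Definition _ :=
  GRing.isZmodMorphism.Build F as_field as_emb_fun as_emb_zmod.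
HB.instance Definition _ :=
  GRing.isMonoidMorphism.Build F as_field as_emb_fun as_emb_monoid.
Definition as_emb : {rmorphism F -> as_field} := as_emb_fun.
Definition as_y : as_field := quadZ 1 as_rhs.

Lemma as_yE : as_y ^+ 2 + as_y = as_emb as_rhs.
Proof.
have := quadZE 1 as_rhs; rewrite rmorph1 mul1r.
exact.
Qed.

Lemma as_coord (A B : F) : as_emb A + as_emb B * as_y = (A, B).
Proof. by have := quadE ((A, B) : quad 1 as_rhs); rewrite /= => ->. Qed.

Lemma as_addE (u v u' v' : F) :
  ((u, v) : as_field) + (u', v') = (u + u', v + v').
Proof. by []. Qed.
Lemma as_mulE (u v u' v' : F) : ((u, v) : as_field) * (u', v') =
  (u * u' + v * v' * as_rhs, u * v' + v * u' - v * v' * 1).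
Proof. by []. Qed.

Local Notation dF := (derF j_frac).
(** Differentiating y^2 + y = g in characteristic 2 forces D y = g', so D (u + v y) = (u' + v g') +
    v' y. *)
Definition as_der (u : as_field) : as_field :=
  (dF u.1 + u.2 * dF as_rhs, dF u.2).

Let dFD := derFD j_inj j_frac.
Let dFM := derFM j_inj j_frac.

Lemma as_der_derivation : derivation as_der.
Proof.
have dF0 : dF 0 = 0 by apply: (addrI (dF 0)); rewrite -dFD !addr0.
have dFN w : dF (- w) = - dF w.
  by apply/eqP; rewrite -addr_eq0 -dFD addNr dF0.
split=> [[u v] [u' v'] | [u v] [u' v']].
  by rewrite as_addE /as_der /= as_addE !dFD; congr pair; ring.
rewrite as_mulE /as_der /= !as_mulE as_addE mulr1.
congr pair; move: as_rhs => g; rewrite !(dFD, dFN, dFM) !(opp2 F2); ring: F2.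
Qed.

Lemma as_der_emb A : as_der (as_emb A) = as_emb (dF A).
Proof.
have dF0 : dF 0 = 0 by apply: (addrI (dF 0)); rewrite -dFD !addr0.
by rewrite /as_der /= dF0 mul0r addr0.
Qed.

Lemma as_field_exists : exists (L : fieldType) (J : {rmorphism F -> L}) (y : L)
    (D : L -> L),
  [/\ y ^+ 2 + y = ff_const j J a * ff_x j J ^+ 3 + ff_const j J b * ff_x j J
                      + ff_const j J c / ff_x j J + ff_const j J d,
    forall h, exists A B, h = J A + J B * y,
    forall A B, J A + J B * y = 0 -> A = 0 /\ B = 0,
    derivation D & (forall e, D (ff_const j J e) = 0) /\ D (ff_x j J) = 1].
Proof.
exists as_field, as_emb, as_y, as_der; split.
- rewrite as_yE /as_rhs; move: as_emb => J.
  by rewrite !rmorphD !(rmorphXn, fmorphV, rmorphM).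
- by move=> [A B]; exists A, B; rewrite as_coord.
- by move=> A B; rewrite as_coord => -[].
- exact: as_der_derivation.
split=> [e|]; rewrite as_der_emb (derF_poly j_inj).
  by rewrite derivC !rmorph0.
by rewrite derivX !rmorph1.
Qed.
End Existence.

Lemma function_field_exists (k : fieldType) (a b c d : k) : 2 = 0 :> k -> c != 0 ->
  exists (F : fieldType) (j : {rmorphism {poly k} -> F}) (L : fieldType)
    (J : {rmorphism F -> L}) (y : L) (D : L -> L),
  [/\ injective j,
    forall z : F, exists p : {poly k} * {poly k}, (p.2 != 0) && (z == j p.1 / j p.2)
    & [/\ y ^+ 2 + y = ff_const j J a * ff_x j J ^+ 3 + ff_const j J b * ff_x j J
                      + ff_const j J c / ff_x j J + ff_const j J d,
    forall h, exists A B, h = J A + J B * y,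
    forall A B, J A + J B * y = 0 -> A = 0 /\ B = 0,
    derivation D & (forall e, D (ff_const j J e) = 0) /\ D (ff_x j J) = 1]].
Proof.
move=> k2 c0; exists {fraction {poly k}}, (@FracField.tofrac {poly k}).
have j_inj : injective (@FracField.tofrac {poly k}).
  by move=> p q /eqP; rewrite tofrac_eq => /eqP.
have j_frac := @frac_exists {poly k}.
have [L [J [y [D H]]]] := as_field_exists j_inj j_frac k2 a b d c0.
by exists L, J, y, D; split.
Qed.

Definition row_of (K : fieldType) (v : 'I_5 -> K) : 'rV[K]_5 := \row_i v i.

(** * Points of the curve and morphisms *)

Lemma proportional_row (K : fieldType) n (v w : 'rV[K]_n.+1) : v != 0 -> w != 0 ->
  (forall i l, v 0 i * w 0 l = v 0 l * w 0 i) -> pt v = pt w.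
Proof.
move=> v0 w0 E; have /rV0Pn[l wl] := w0; apply/pt_eq => //.
exists (v 0 l / w 0 l).
  apply: contra_neq v0 => /eqP; rewrite mulf_eq0 invr_eq0 (negPf wl) orbF => /eqP vl.
  apply/rowP=> i; rewrite mxE; apply: (mulIf wl).
  by rewrite E vl !mul0r.
by apply/rowP=> i; rewrite mxE mulrAC -E mulfK.
Qed.

(** Zero vectors satisfy the minors trivially. Equality of points wherever both sides make sense
    thus becomes a polynomial identity at all points, which can be carried over to L. *)
Lemma pt_minors (K : fieldType) n (v w : 'rV[K]_n.+1) :
  (v != 0 -> w != 0 -> pt v = pt w) -> forall i l, v 0 i * w 0 l = v 0 l * w 0 i.
Proof.
have [-> _|v0] := eqVneq v 0; first by move=> i l; rewrite !mxE !mul0r.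
have [-> _|w0] := eqVneq w 0; first by move=> i l; rewrite !mxE !mulr0.
by move=> /(_ isT isT)/(pt_eq v0 w0)[t _ ->] i l; rewrite !mxE; ring.
Qed.

Section EvalHomogeneous.
Variables (k K : fieldType) (f : {rmorphism k -> K}).

Lemma evalpE n (p : {mpoly k[n.+1]}) v : evalp f p v = mmap f (v 0) p.
Proof.
apply: (@mmap_morph _ _ _ _ (@mpolyC n.+1 K \o f) (meval (v 0))) => [c|i].
  exact: mevalC.
exact: mevalXU.
Qed.

Lemma evalv_scale n m e (F : 'I_m.+1 -> {mpoly k[n.+1]}) v t :
  (forall i, F i \is e.-homog) -> evalv f F (t *: v) = t ^+ e *: evalv f F v.
Proof.
move=> Fe; apply/rowP=> i; rewrite !mxE !evalpE; apply: mmap_homog => // l.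
by rewrite mxE.
Qed.

Variables (n m : nat) (X : pred (projpt K n)) (phi : projpt K n -> projpt K m).

Definition local_rep e (F : 'I_m.+1 -> {mpoly k[n.+1]}) :=
  (forall i, F i \is e.-homog) /\
  {in X, forall Q, evalv f F (coords Q) != 0 -> phi Q = pt (evalv f F (coords Q))}.

Lemma local_rep_pt e F v : local_rep e F -> v != 0 -> pt v \in X ->
  evalv f F v != 0 -> phi (pt v) = pt (evalv f F v).
Proof.
move=> [Fe Fphi] v0 vX Fv; have [t t0 tv] := coords_pt v0.
have := Fphi _ vX; rewrite tv (evalv_scale _ _ Fe).
have te0 : t ^+ e != 0 by rewrite expf_neq0.
have FtV : t ^+ e *: evalv f F v != 0 by rewrite scaler_eq0 negb_or te0.
by move=> /(_ FtV) ->; apply/pt_eq => //; exists (t ^+ e).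
Qed.

Lemma local_rep_exists (Y : pred (projpt K m)) v : morphism_over f X Y phi ->
  v != 0 -> pt v \in X -> exists e F, local_rep e F /\ evalv f F v != 0.
Proof.
move=> [_ mor] v0 vX; have [e [F [Fe F0 Fphi]]] := mor _ vX.
exists e, F; split=> //; have [t t0 tv] := coords_pt v0.
by apply: contra_neq F0 => E; rewrite tv (evalv_scale _ _ Fe) E scaler0.
Qed.
End EvalHomogeneous.

Section CurveCone.
Variables (k K : fieldType) (f : {rmorphism k -> K}) (a b c d : k).

(** The equations of the curve with coordinates in an arbitrary ring, so that they also apply to the
    generic point over L. *)
Definition on_cone (R : comNzRingType) (h : {rmorphism k -> R}) (u : 'I_5 -> R) :=
  let v l := u (inord l) in
  [/\ v 0 * v 2 = v 1 ^+ 2, v 0 * v 3 = v 1 * v 2, v 1 * v 3 = v 2 ^+ 2 &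
      v 4 ^+ 2 + v 2 * v 4 = h a * (v 0 * v 1) + h b * (v 0 * v 3)
                           + h c * (v 2 * v 3) + h d * (v 1 * v 3)].

Lemma curve_coords P : P \in curve f a b c d <-> on_cone f (coords P 0).
Proof.
rewrite unfold_in /curve /zeros /= andbT !expr2.
rewrite !(evalpB, evalpD, evalpM, evalpZ, evalpX) !subr_eq0 /on_cone !expr2.
split; first by case/and4P=> /eqP ? /eqP ? /eqP ? /eqP ?.
by case=> -> -> -> ->; rewrite !eqxx.
Qed.

Lemma on_cone_scale (R : comNzRingType) (h : {rmorphism k -> R}) t u w :
  (forall i, w i = t * u i) -> on_cone h u -> on_cone h w.
Proof.
move=> E [h1 h2 h3 h4]; rewrite /on_cone !E; split.
- by transitivity (t ^+ 2 * (u (inord 0) * u (inord 2))); [|rewrite h1]; ring.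
- by transitivity (t ^+ 2 * (u (inord 0) * u (inord 3))); [|rewrite h2]; ring.
- by transitivity (t ^+ 2 * (u (inord 1) * u (inord 3))); [|rewrite h3]; ring.
transitivity (t ^+ 2 * (u (inord 4) ^+ 2 + u (inord 2) * u (inord 4))); first by ring.
by rewrite h4; ring.
Qed.

Lemma curve_pt v : v != 0 -> pt v \in curve f a b c d <-> on_cone f (v 0).
Proof.
move=> v0; rewrite curve_coords; have [t t0 ->] := coords_pt v0.
split; [apply: (on_cone_scale (t := t^-1)) | apply: (on_cone_scale (t := t))] => i;
  by rewrite mxE ?mulKf.
Qed.

Lemma pt_over_inftyE : pt_over_infty K = pt (row_of (vec5 1 0 0 0 0)).
Proof.
by congr pt; apply/rowP=> i; rewrite !mxE /vec5; case: i => [[|[|[|[|[|]]]]]].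
Qed.

(* The affine part of the curve, including its point over x = 0. *)
Lemma curve_points P : P \in curve f a b c d ->
  P = pt (row_of (vec5 1 0 0 0 0)) \/
  exists q s, on_chart (m_zero k) (n_zero a b c d) f q s /\
    P = pt (row_of (vec5 (q ^+ 3) (q ^+ 2) q 1 s)).
Proof.
rewrite -pt_over_inftyE; case/curveP=> [->|->|[q [s [q0 E ->]]]].
- right; exists 0, 0; split; first by rewrite /on_chart hpX hp_n_zero; ring.
  congr pt; apply/rowP=> i; rewrite !mxE /vec5 !expr0n.
  by case: i => [[|[|[|[|[|]]]]]].
- by left.
right; exists q, (q * s); split.
  rewrite /on_chart hpX hp_n_zero.
  transitivity (q ^+ 2 * (s ^+ 2 + s)); first by ring.
  by rewrite E; field.
by congr pt; apply/rowP=> i; rewrite !mxE /vec5; case: i => [[|[|[|[|[|]]]]]].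
Qed.

Lemma chart_point_neq0 (q s : K) : row_of (vec5 (q ^+ 3) (q ^+ 2) q 1 s) != 0.
Proof.
by apply/eqP=> /rowP/(_ (inord 3)) /eqP; rewrite !mxE vec5E oner_eq0.
Qed.

Lemma infty_neq0 : row_of (vec5 1 0 0 0 0) != 0 :> 'rV[K]_5.
Proof.
by apply/eqP=> /rowP/(_ (inord 0)) /eqP; rewrite !mxE vec5E oner_eq0.
Qed.

Lemma chart_curve q s : on_chart (m_zero k) (n_zero a b c d) f q s ->
  pt (row_of (vec5 (q ^+ 3) (q ^+ 2) q 1 s)) \in curve f a b c d.
Proof.
rewrite /on_chart hpX hp_n_zero => E; apply/(curve_pt (chart_point_neq0 q s)).
rewrite /on_cone !mxE !vec5E; split; try ring.
by rewrite E; ring.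
Qed.

Lemma infty_curve : pt (row_of (vec5 1 0 0 0 0)) \in curve f a b c d.
Proof.
apply/(curve_pt infty_neq0); rewrite /on_cone !mxE !vec5E; split; ring.
Qed.
End CurveCone.

(* (x, y) |-> (la x, y + r) in the coordinates of P^4. *)
Definition linpoly (k : fieldType) (la r : k) : 'I_5 -> {mpoly k[5]} :=
  let u (l : nat) : {mpoly k[5]} := 'X_(inord l) in
  vec5 (la ^+ 3 *: u 0%N) (la ^+ 2 *: u 1%N) (la *: u 2%N) (u 3%N)
       (la *: (u 4%N + r *: u 2%N)).

Lemma mmap_linpoly (k : fieldType) (R : comNzRingType) (h : {rmorphism k -> R})
    (la r : k) u i :
  mmap h u (linpoly la r i) =
  vec5 (h la ^+ 3 * u (inord 0)) (h la ^+ 2 * u (inord 1)) (h la * u (inord 2))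
    (u (inord 3)) (h la * (u (inord 4) + h r * u (inord 2))) i.
Proof.
move: i; apply: ord5P;
  rewrite /linpoly !vec5E ?(mmapZ, mmapD, mmapX, mmap1U) ?rmorphXn //=.
Qed.

Definition linmap (k K : fieldType) (f : {rmorphism k -> K}) (la r : k)
  (P : projpt K 4) : projpt K 4 := pt (evalv f (linpoly la r) (coords P)).

Lemma linmap_neq0 (k K : fieldType) (f : {rmorphism k -> K}) la r (u : 'rV[K]_5) :
  la != 0 -> u != 0 -> evalv f (linpoly la r) u != 0.
Proof.
move=> la0; apply: contra_neq => /rowP lu; apply/rowP=> i; rewrite [RHS]mxE.
have {}lu l : vec5 (f la ^+ 3 * u 0 (inord 0)) (f la ^+ 2 * u 0 (inord 1))
    (f la * u 0 (inord 2)) (u 0 (inord 3))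
    (f la * (u 0 (inord 4) + f r * u 0 (inord 2))) l = 0.
  by have := lu l; rewrite !mxE evalpE mmap_linpoly.
have la0' : f la != 0 by rewrite fmorph_eq0.
have u2 : u 0 (inord 2) = 0.
  by have := lu (inord 2); rewrite vec5E => /eqP; rewrite mulf_eq0 (negPf la0') => /eqP.
move: i; apply: ord5P => //.
- have /eqP := lu (inord 0); rewrite vec5E mulf_eq0 expf_eq0 (negPf la0').
  by move/eqP.
- have /eqP := lu (inord 1); rewrite vec5E mulf_eq0 expf_eq0 (negPf la0').
  by move/eqP.
- by have := lu (inord 3); rewrite vec5E.
have /eqP := lu (inord 4); rewrite vec5E u2 mulr0 addr0 mulf_eq0 (negPf la0').
by move/eqP.
Qed.

Lemma linmap_pt (k K : fieldType) (f : {rmorphism k -> K}) la r (u : 'rV[K]_5) :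
  la != 0 -> u != 0 -> linmap f la r (pt u) = pt (evalv f (linpoly la r) u).
Proof.
move=> la0 u0; rewrite /linmap; have [t t0 tE] := coords_pt u0; rewrite tE.
have tu : t *: u != 0 by rewrite scaler_eq0 negb_or t0.
apply/pt_eq; rewrite ?linmap_neq0 //; exists t => //.
apply/rowP=> i; rewrite !mxE !evalpE !mmap_linpoly.
by move: i; apply: ord5P; rewrite !vec5E !mxE; ring.
Qed.

Local Opaque chart.

(** * The image of the generic point under a morphism *)

Section Geometry.
Variables (k F : fieldType) (j : {rmorphism {poly k} -> F}).
Hypothesis j_inj : injective j.
Hypothesis j_frac :
  forall z : F, exists p : {poly k} * {poly k}, (p.2 != 0) && (z == j p.1 / j p.2).
Hypothesis k2 : 2 = 0 :> k.
Variables (L : fieldType) (J : {rmorphism F -> L}) (y : L) (a b c d : k).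
Local Notation hL := (ff_const j J).
Local Notation x := (ff_x j J).
Hypothesis c0 : c != 0.
Hypothesis yE : y ^+ 2 + y = hL a * x ^+ 3 + hL b * x + hL c / x + hL d.
Hypothesis Lspan : forall h, exists A B, h = J A + J B * y.
Hypothesis Lfree : forall A B, J A + J B * y = 0 -> A = 0 /\ B = 0.
Variable D : L -> L.
Hypotheses (der : derivation D) (D_hL : forall e, D (hL e) = 0) (Dx : D x = 1).
Variables (K : closedFieldType) (f : {rmorphism k -> K}).
Variables (a2 b2 c2 d2 : k).
Hypotheses (a20 : a2 != 0) (c20 : c2 != 0).
Variables (phi psi : projpt K 4 -> projpt K 4).
Local Notation C := (curve f a b c d).
Local Notation C2 := (curve f a2 b2 c2 d2).
Hypothesis phi_mor : morphism_over f C C2 phi.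
Hypothesis psi_mor : morphism_over f C2 C psi.
Hypothesis phiK : {in C, cancel phi psi}.

Local Notation m0 := (m_zero k).
Local Notation n0 := (n_zero a b c d).
Local Notation mi := (m_inf k).
Local Notation ni := (n_inf a b c d).
Local Notation T0 := (quad m0 n0).
Local Notation Ti := (quad mi ni).
Local Notation E0 := (on_chart0 j_inj yE).
Local Notation Ei := (on_chart_inf j_inj yE).
Local Notation iota0 := (chart E0).
Local Notation iota_inf := (chart Ei).
Local Notation cT0 := (chart_const m0 n0).
Local Notation cTi := (chart_const mi ni).

Definition coords_zero : 'I_5 -> T0 :=
  let X := quadC m0 n0 'X in vec5 (X ^+ 3) (X ^+ 2) X 1 (quadZ m0 n0).
(** The tricanonical coordinates divided by x^3, written in s = 1/x and w = y/x^2. *)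
Definition coords_inf : 'I_5 -> Ti :=
  let X := quadC mi ni 'X in vec5 1 X (X ^+ 2) (X ^+ 3) (quadZ mi ni).
Definition row_zero (q s : K) : 'rV[K]_5 := row_of (vec5 (q ^+ 3) (q ^+ 2) q 1 s).
Definition row_inf : 'rV[K]_5 := row_of (vec5 1 0 0 0 0).

Lemma iota_coords_zero i : iota0 (coords_zero i) = tricanonical x y i.
Proof.
move: i; apply: ord5P; rewrite /coords_zero /tricanonical !vec5E ?rmorphXn /=;
  by rewrite ?chartX ?chartZ ?rmorph1.
Qed.

Lemma iota_coords_inf i : iota_inf (coords_inf i) = x^-1 ^+ 3 * tricanonical x y i.
Proof.
have X0 := ff_x_neq0 j_inj J.
move: i; apply: ord5P; rewrite /coords_inf /tricanonical !vec5E ?rmorphXn /=;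
  rewrite ?chartX ?chartZ ?rmorph1; by field.
Qed.

Lemma ev_coords_zero q s (Eq : on_chart m0 n0 f q s) i :
  chart Eq (coords_zero i) = row_zero q s 0 i.
Proof.
rewrite mxE; move: i; apply: ord5P; rewrite /coords_zero !vec5E ?rmorphXn /=;
  by rewrite ?chartX ?chartZ ?rmorph1.
Qed.

Lemma ev_coords_inf i : chart (on_chart_inf0 a b c d f) (coords_inf i) = row_inf 0 i.
Proof.
rewrite mxE; move: i; apply: ord5P; rewrite /coords_inf !vec5E ?rmorphXn /=;
  by rewrite ?chartX ?chartZ ?rmorph1 ?expr0n.
Qed.

Definition chart_eval (p : {mpoly k[5]}) : T0 := mmap cT0 coords_zero p.
Definition ff_eval (p : {mpoly k[5]}) : L := mmap hL (tricanonical x y) p.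

Lemma iota_chart_eval p : iota0 (chart_eval p) = ff_eval p.
Proof.
by apply: mmap_morph => [e|i]; [apply: chart_constE | apply: iota_coords_zero].
Qed.

Lemma ev_chart_eval q s (Eq : on_chart m0 n0 f q s) p :
  chart Eq (chart_eval p) = evalp f p (row_zero q s).
Proof.
rewrite evalpE.
by apply: mmap_morph => [e|i]; [apply: chart_constE | apply: ev_coords_zero].
Qed.

Let I0 : injective iota0 := iota0_inj Lfree.
Let ztest (P : T0) : (forall q s (Eq : on_chart m0 n0 f q s), chart Eq P = 0) -> P = 0.
Proof. exact: zero_test I0 _ _ _. Qed.

Lemma row_zero_neq0 q s : row_zero q s != 0. Proof. exact: chart_point_neq0. Qed.
Lemma row_inf_neq0 : row_inf != 0. Proof. exact: infty_neq0. Qed.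

Lemma ff_evalM p q : ff_eval (p * q) = ff_eval p * ff_eval q. Proof. exact: rmorphM. Qed.
Lemma ff_evalD p q : ff_eval (p + q) = ff_eval p + ff_eval q. Proof. exact: mmapD. Qed.
Lemma ff_evalB p q : ff_eval (p - q) = ff_eval p - ff_eval q. Proof. exact: mmapB. Qed.
Lemma ff_evalZ e p : ff_eval (e *: p) = hL e * ff_eval p. Proof. exact: mmapZ. Qed.
Lemma ff_evalX i : ff_eval 'X_i = tricanonical x y i.
Proof. by rewrite /ff_eval mmapX mmap1U. Qed.

Local Opaque chart_eval ff_eval.
(** The difference, read in the finite chart ring, vanishes at all points and is zero by
    [zero_test]. This is how pointwise statements reach L. *)
Lemma ff_eval_eq p p' : (forall q s, on_chart m0 n0 f q s ->
  evalp f p (row_zero q s) = evalp f p' (row_zero q s)) -> ff_eval p = ff_eval p'.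
Proof.
move=> pE; apply/eqP; rewrite -subr_eq0 -ff_evalB -iota_chart_eval; apply/eqP.
rewrite (_ : chart_eval (p - p') = 0) ?rmorph0 //; apply: ztest => q s Eq.
by rewrite ev_chart_eval evalpB pE // subrr.
Qed.

Lemma ff_eval_neq0 p q s : on_chart m0 n0 f q s ->
  evalp f p (row_zero q s) != 0 -> ff_eval p != 0.
Proof.
move=> Eq p0; rewrite -iota_chart_eval.
by apply: (ev_iota0 (ev := chart Eq) I0); rewrite ev_chart_eval.
Qed.

(** Wherever both representatives are nonzero they give the same point, so their minors vanish at
    every point of the finite chart. *)
Lemma reps_agree e F1 e' F2 : local_rep f C phi e F1 -> local_rep f C phi e' F2 ->
  forall i l, ff_eval (F1 i) * ff_eval (F2 l) = ff_eval (F1 l) * ff_eval (F2 i).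
Proof.
move=> R1 R2 i l; rewrite -!ff_evalM; apply: ff_eval_eq => q s Eq; rewrite !evalpM.
have evE (G : 'I_5 -> {mpoly k[5]}) n :
    evalp f (G n) (row_zero q s) = evalv f G (row_zero q s) 0 n.
  by rewrite mxE.
rewrite !evE; apply: pt_minors => F10 F20.
have QC := chart_curve Eq.
exact: etrans (esym (local_rep_pt R1 (row_zero_neq0 q s) QC F10))
              (local_rep_pt R2 (row_zero_neq0 q s) QC F20).
Qed.

Lemma rep_on_cone e G : local_rep f C phi e G ->
  on_cone a2 b2 c2 d2 hL (fun i => ff_eval (G i)).
Proof.
move=> R; have cone q s (Eq : on_chart m0 n0 f q s) :
    on_cone a2 b2 c2 d2 f (evalv f G (row_zero q s) 0).
  have [->|G0] := eqVneq (evalv f G (row_zero q s)) 0.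
    by rewrite /on_cone !mxE; split; ring.
  have QC := chart_curve Eq.
  apply/(curve_pt _ _ _ _ _ G0); rewrite -(local_rep_pt R (row_zero_neq0 q s) QC G0).
  by case: phi_mor => + _; apply.
pose g l := G (inord l).
have e1 : ff_eval (g 0 * g 2) = ff_eval (g 1 * g 1).
  apply: ff_eval_eq => q s Eq; have [+ _ _ _] := cone q s Eq.
  by rewrite !mxE !evalpM expr2.
have e2 : ff_eval (g 0 * g 3) = ff_eval (g 1 * g 2).
  apply: ff_eval_eq => q s Eq; have [_ + _ _] := cone q s Eq.
  by rewrite !mxE !evalpM.
have e3 : ff_eval (g 1 * g 3) = ff_eval (g 2 * g 2).
  apply: ff_eval_eq => q s Eq; have [_ _ + _] := cone q s Eq.
  by rewrite !mxE !evalpM expr2.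
have e4 : ff_eval (g 4 * g 4 + g 2 * g 4) =
    ff_eval (a2 *: (g 0 * g 1) + b2 *: (g 0 * g 3)
             + c2 *: (g 2 * g 3) + d2 *: (g 1 * g 3)).
  apply: ff_eval_eq => q s Eq; have [_ _ _ +] := cone q s Eq.
  by rewrite !mxE !(evalpD, evalpM, evalpZ) expr2.
move: e1 e2 e3 e4; rewrite !(ff_evalD, ff_evalM, ff_evalZ) /on_cone !expr2 => e1 e2 e3 e4.
by split.
Qed.

Lemma rep_neq0 (G : 'I_5 -> {mpoly k[5]}) q s : on_chart m0 n0 f q s ->
  evalv f G (row_zero q s) != 0 -> exists i, ff_eval (G i) != 0.
Proof.
by move=> Eq /rV0Pn[i Gi]; exists i; apply: (ff_eval_neq0 Eq); rewrite mxE in Gi.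
Qed.

(* Composing with the inverse expresses x by the coordinates of phi, so these
   cannot all be killed by D. *)
Lemma rep_separable e G q0 s0 (Eq0 : on_chart m0 n0 f q0 s0) tau u' :
  local_rep f C phi e G -> evalv f G (row_zero q0 s0) != 0 ->
  (forall i, ff_eval (G i) = tau * u' i) -> (forall i, D (u' i) = 0) -> False.
Proof.
move=> R G0 uE Du'.
have QC := chart_curve Eq0.
have phiC2 : pt (evalv f G (row_zero q0 s0)) \in C2.
  rewrite -(local_rep_pt R (row_zero_neq0 q0 s0) QC G0).
  by case: phi_mor => + _; apply.
have [g [H [RH H0]]] := local_rep_exists psi_mor G0 phiC2.
(* The composite of the representatives G of phi and H of psi. *)
pose W i : {mpoly k[5]} := mmap (@mpolyC 5 k) G (H i).
have evW q s i : evalp f (W i) (row_zero q s) = evalv f H (evalv f G (row_zero q s)) 0 i.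
  rewrite mxE !evalpE; apply: (@mmap_morph _ _ _ _ _ (mmap f _)) => [e'|l].
    exact: mmapC.
  by rewrite mxE evalpE.
have uW i : ff_eval (W i) = mmap hL (fun i => ff_eval (G i)) (H i).
  apply: (@mmap_morph _ _ _ _ _ (mmap hL _)) => [e'|//]; exact: mmapC.
have [l Gl] := rep_neq0 Eq0 G0.
have minor i n : ff_eval (W i) * tricanonical x y n = ff_eval (W n) * tricanonical x y i.
  (* The factor G l makes the identity trivial at points where G l vanishes; elsewhere G is nonzero
     and psi (phi Q) = Q applies. The factor is then cancelled in L. *)
  apply: (mulIf Gl); rewrite -!ff_evalX -!ff_evalM; apply: ff_eval_eq => q s Eq.
  rewrite !evalpM !evW !evalpX.
  have [->|Gl0] := eqVneq (evalp f (G l) (row_zero q s)) 0; first by rewrite !mulr0.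
  congr (_ * _); apply: pt_minors => Hqs _.
  have Gqs : evalv f G (row_zero q s) != 0.
    by apply: contraNneq Gl0 => /rowP/(_ l); rewrite [RHS]mxE mxE => ->.
  have QC' := chart_curve Eq.
  have phiQ := local_rep_pt R (row_zero_neq0 q s) QC' Gqs.
  have phiQC : pt (evalv f G (row_zero q s)) \in C2.
    by rewrite -phiQ; case: phi_mor => + _; apply.
  exact: etrans (esym (local_rep_pt RH Gqs phiQC Hqs))
                (etrans (congr1 psi (esym phiQ)) (phiK QC')).
have [n Hn] : exists n, ff_eval (W n) != 0.
  by have /rV0Pn[n Hn] := H0; exists n; apply: (ff_eval_neq0 Eq0); rewrite evW.
have W3 : ff_eval (W (inord 3)) != 0.
  apply: contra_neq Hn => W3; have := minor n (inord 3).
  by rewrite W3 mul0r /tricanonical !vec5E mulr1.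
have W2 : ff_eval (W (inord 2)) = ff_eval (W (inord 3)) * x.
  by rewrite -[LHS]mulr1; have := minor (inord 2) (inord 3); rewrite /tricanonical !vec5E.
pose h i := mmap hL u' (H i).
have hE i : ff_eval (W i) = tau ^+ g * h i.
  by rewrite uW; apply: mmap_homog => //; case: RH => + _; apply.
have Dh i : D (h i) = 0 by apply: der_mmap.
have taug : tau ^+ g != 0 by apply: contraNneq W3 => tau0; rewrite hE tau0 mul0r.
have h3 : h (inord 3) != 0 by apply: contraNneq W3 => h0; rewrite hE h0 mulr0.
have h2 : h (inord 2) = h (inord 3) * x.
  by apply: (mulfI taug); rewrite -hE W2 hE mulrA.
(* Both h 2 and h 3 are killed by D, but h 2 = h 3 * x and D x = 1, so h 3 would be zero. *)
have := Dh (inord 2); rewrite h2 (derM der) Dh mul0r add0r Dx mulr1.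
by apply/eqP.
Qed.

Lemma chart00 : on_chart m0 n0 f 0 0.
Proof. by rewrite /on_chart hpX hp_n_zero; ring. Qed.

Lemma global_rep : exists e G X Y tau, [/\ local_rep f C phi e G, tau != 0,
  (forall i, ff_eval (G i) = tau * tricanonical X Y i),
  X != 0 /\ D X != 0 &
  Y ^+ 2 + Y = hL a2 * X ^+ 3 + hL b2 * X + hL c2 / X + hL d2].
Proof.
have [e [G [R G0]]] := local_rep_exists phi_mor (row_zero_neq0 0 0) (chart_curve chart00).
have sep := rep_separable chart00 R G0.
have [n Gn] := rep_neq0 chart00 G0.
have [] := rep_on_cone R.
have D0 := der0 der; have D1 := der1 der.
set u0 := ff_eval (G (inord 0)); set u1 := ff_eval (G (inord 1)).
set u2 := ff_eval (G (inord 2)).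
set u3 := ff_eval (G (inord 3)); set u4 := ff_eval (G (inord 4)) => r1 r2 r3 r4.
have u2n : u2 != 0.
  (* If u2 = 0, the image of the generic point is one of the two points over X = 0 and X = oo, whose
     coordinates are constants; this contradicts [rep_separable]. *)
  apply/eqP=> u20.
  have u10 : u1 = 0 by apply/eqP; rewrite -sqrf_eq0 -r1 u20 mulr0.
  have /eqP : u0 * u3 = 0 by rewrite r2 u10 mul0r.
  have u40 : u4 = 0.
    apply/eqP; rewrite -sqrf_eq0; move: r4.
    by rewrite r2 u20 u10 !(mul0r, mulr0, addr0) => ->.
  rewrite mulf_eq0 => /orP[/eqP u00|/eqP u30].
    apply: (sep u3 (vec5 0 0 0 1 0)); apply: ord5P; rewrite ?vec5E ?mulr0 ?mulr1 //.
  apply: (sep u0 (vec5 1 0 0 0 0)); apply: ord5P; rewrite ?vec5E ?mulr0 ?mulr1 //.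
have : u1 * u3 != 0 by rewrite r3 expf_neq0.
rewrite mulf_eq0 negb_or => /andP[u1n u3n].
pose X := u2 / u3; pose Y := u4 / u2.
have Xn : X != 0 by rewrite mulf_neq0 ?invr_eq0.
have e1 : u1 = u2 ^+ 2 / u3 by rewrite -r3 mulfK.
have e0 : u0 = u2 ^+ 3 / u3 ^+ 2 by apply: (mulIf u3n); rewrite r2 e1; field.
have uE i : ff_eval (G i) = u3 * tricanonical X Y i.
  move: i; apply: ord5P; rewrite /tricanonical !vec5E -/u0 -/u1 -/u2 -/u3 -/u4.
  - by rewrite e0 /X; field.
  - by rewrite e1 /X; field.
  - by rewrite /X; field.
  - by rewrite mulr1.
  - by rewrite /X /Y; field; rewrite u2n u3n.
have XY : Y ^+ 2 + Y = hL a2 * X ^+ 3 + hL b2 * X + hL c2 / X + hL d2.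
  transitivity ((u4 ^+ 2 + u2 * u4) / u2 ^+ 2); first by rewrite /Y; field.
  by rewrite r4 e0 e1 /X; field; rewrite u2n u3n.
exists e, G, X, Y, u3; split=> //; split=> //.
(* If D X = 0, the equation gives D Y = 0, and all tricanonical coordinates of (X, Y) are killed by
   D. *)
apply/eqP=> DX; apply: (sep _ _ uE).
have L2' := @ff_two _ _ j k2 _ J.
have DY : D Y = 0 by rewrite (derY L2' der D_hL Xn XY) DX mulr0.
apply: ord5P; rewrite /tricanonical !vec5E ?(derX0 der) //.
by rewrite (derM der) DX DY mul0r mulr0 addr0.
Qed.

Lemma iota_coords_inf_homog e (p : {mpoly k[5]}) : p \is e.-homog ->
  iota_inf (mmap cTi coords_inf p) = (x^-1 ^+ 3) ^+ e * ff_eval p.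
Proof.
move=> pe; rewrite -(mmap_homog hL (v := tricanonical x y)
  (w := fun i => x^-1 ^+ 3 * tricanonical x y i) pe) //.
by apply: mmap_morph => [e'|i]; [apply: chart_constE | apply: iota_coords_inf].
Qed.

Lemma ev_coords_inf_poly p :
  chart (on_chart_inf0 a b c d f) (mmap cTi coords_inf p) = evalp f p row_inf.
Proof.
rewrite evalpE.
by apply: mmap_morph => [e'|i]; [apply: chart_constE | apply: ev_coords_inf].
Qed.

(* The values at a point of a local representative of phi determine phi there,
   and they are proportional to those of the linear map. *)
Lemma local_linmap (T : comNzRingType) (iota : {rmorphism T -> L})
    (ev : {rmorphism T -> K}) (h : {rmorphism k -> T}) (v : 'I_5 -> T)
    (vk : 'rV[K]_5) (P : 'I_5 -> T) (w : 'rV[K]_5) tau sig la r :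
  injective iota -> (forall e, iota (h e) = hL e) -> (forall e, ev (h e) = f e) ->
  (forall i, iota (v i) = sig * tricanonical x y i) -> (forall i, ev (v i) = vk 0 i) ->
  (forall i, iota (P i) = tau * tricanonical (hL la * x) (y + hL r) i) ->
  (forall i, ev (P i) = w 0 i) -> vk != 0 -> w != 0 -> la != 0 ->
  pt w = linmap f la r (pt vk).
Proof.
move=> inj iotah evh iotav evv iotaP evP vk0 w0 la0.
rewrite linmap_pt //.
apply: proportional_row; rewrite ?linmap_neq0 // => i l.
pose lv i := mmap h v (linpoly la r i).
have evl n : ev (lv n) = evalv f (linpoly la r) vk 0 n.
  by rewrite mxE evalpE; apply: mmap_morph.
rewrite -!evl -!evP -!rmorphM; congr (ev _); apply: inj.
have iotal n : iota (lv n) = sig * tricanonical (hL la * x) (y + hL r) n.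
  rewrite /lv (mmap_morph (h' := hL) (w := fun n => sig * tricanonical x y n)) //.
  rewrite mmap_linpoly; move: n; apply: ord5P; rewrite /tricanonical !vec5E; ring.
by rewrite !rmorphM !iotal !iotaP; ring.
Qed.

Theorem morphism_linmap : exists la r, [/\ la != 0, {in C, phi =1 linmap f la r}
  & [/\ a = la ^+ 3 * a2, b = la * b2, c = la^-1 * c2 & r ^+ 2 + r = d + d2]].
Proof.
have [e [G [X [Y [t [RG t0 uE [X0 DX0] XY]]]]]] := global_rep.
(* By [reps_agree] every representative, whichever point it serves, gives the same X and Y. *)
have rep e' H : local_rep f C phi e' H ->
    forall i, ff_eval (H i) = ff_eval (H (inord 3)) * tricanonical X Y i.
  move=> RH i; apply: (mulIf t0); have := reps_agree RH RG i (inord 3).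
  by rewrite !uE [X in _ * (_ * X)]/tricanonical vec5E mulr1 => ->; ring.
have rep_inf e' H : local_rep f C phi e' H -> forall i,
    iota_inf (mmap cTi coords_inf (H i)) =
    (x^-1 ^+ 3) ^+ e' * ff_eval (H (inord 3)) * tricanonical X Y i.
  move=> RH i; have He : H i \is e'.-homog by case: RH.
  by apply: etrans (iota_coords_inf_homog He) _; rewrite (rep _ _ RH i) mulrA.
have pt0 q s (Eq : on_chart m0 n0 f q s) :=
  local_rep_exists phi_mor (row_zero_neq0 q s) (chart_curve Eq).
have pti := local_rep_exists phi_mor row_inf_neq0 (infty_curve f a b c d).
have xn0 := ff_x_neq0 j_inj J.
have [la [r [la0 XE YE rel]]] : exists la r : k, [/\ la != 0, X = hL la * x,
    Y = y + hL r & [/\ a = la ^+ 3 * a2, b = la * b2, c = la^-1 * c2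
    & r ^+ 2 + r = d + d2]].
  apply: (function_field_map j_frac k2 c0 Lspan Lfree der D_hL Dx a20 c20 X0 DX0 XY).
    move=> q s Eq; have [e' [H [RH H0]]] := pt0 q s Eq.
    exists (fun i => chart_eval (H i)), (ff_eval (H (inord 3))); split.
      by move=> i; apply: etrans (iota_chart_eval _) (rep _ _ RH i).
    by have /rV0Pn[i Hi] := H0; exists i; rewrite ev_chart_eval; rewrite mxE in Hi.
  have [e' [H [RH H0]]] := pti.
  exists (fun i => mmap cTi coords_inf (H i)),
    ((x^-1 ^+ 3) ^+ e' * ff_eval (H (inord 3))); split.
    by move=> i; apply: rep_inf RH i.
  by have /rV0Pn[i Hi] := H0; exists i; rewrite ev_coords_inf_poly; rewrite mxE in Hi.
(* At each point a representative that is nonzero there is compared with the linear map inside the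
   ring of a chart containing the point. *)
exists la, r; split=> // Q /curve_points[->|[q [s [Eq ->]]]].
  have [e' [H [RH H0]]] := pti.
  rewrite (local_rep_pt RH row_inf_neq0 (infty_curve f a b c d) H0).
  apply: (local_linmap (iota := iota_inf) (ev := chart (on_chart_inf0 a b c d f))
    (h := cTi) (v := coords_inf) (P := fun i => mmap cTi coords_inf (H i))
    (tau := (x^-1 ^+ 3) ^+ e' * ff_eval (H (inord 3)))); rewrite ?row_inf_neq0 //.
  - exact: iota_inf_inj Lfree.
  - exact: chart_constE.
  - exact: chart_constE.
  - exact: iota_coords_inf.
  - exact: ev_coords_inf.
  - by move=> i; rewrite -XE -YE; apply: rep_inf RH i.
  - by move=> i; rewrite ev_coords_inf_poly mxE.
have [e' [H [RH H0]]] := pt0 q s Eq.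
rewrite (local_rep_pt RH (row_zero_neq0 q s) (chart_curve Eq) H0).
apply: (local_linmap (iota := iota0) (ev := chart Eq)
  (h := cT0) (v := coords_zero) (P := fun i => chart_eval (H i)) (sig := 1)
  (tau := ff_eval (H (inord 3)))); rewrite ?row_zero_neq0 //.
- exact: chart_constE.
- exact: chart_constE.
- by move=> i; rewrite mul1r iota_coords_zero.
- exact: ev_coords_zero.
- by move=> i; rewrite -XE -YE; apply: etrans (iota_chart_eval _) (rep _ _ RH i).
- by move=> i; rewrite ev_chart_eval mxE.
Qed.
End Geometry.

(** * The isomorphisms (x, y) |-> (la x, y + r) *)

Section LinearMaps.
Variables (k K : fieldType) (f : {rmorphism k -> K}).
Hypothesis k2 : 2 = 0 :> k.

Let K2 : 2 = 0 :> K.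
Proof. by rewrite -(rmorph0 f) -k2 rmorphMn rmorph1. Qed.

Lemma evalv_linpoly la r (u : 'rV[K]_5) i : evalv f (linpoly la r) u 0 i =
  vec5 (f la ^+ 3 * u 0 (inord 0)) (f la ^+ 2 * u 0 (inord 1)) (f la * u 0 (inord 2))
    (u 0 (inord 3)) (f la * (u 0 (inord 4) + f r * u 0 (inord 2))) i.
Proof. by rewrite mxE evalpE mmap_linpoly. Qed.

(** In characteristic 2 the translation by r is its own inverse, so only la has to be inverted. *)
Lemma linmap_inv la r (P : projpt K 4) : la != 0 ->
  linmap f la^-1 r (linmap f la r P) = P.
Proof.
move=> la0; have u0 := coords_neq0 P.
rewrite -[in RHS](coordsK P) {2}/linmap linmap_pt ?linmap_neq0 ?invr_eq0 //.
congr pt; apply/rowP=> i; rewrite evalv_linpoly.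
have fla : f la != 0 by rewrite fmorph_eq0.
move: i; apply: ord5P; rewrite !vec5E !evalv_linpoly !vec5E // fmorphV.
- by field.
- by field.
- by field.
by field: K2.
Qed.

Lemma linpoly_homog (la r : k) i : linpoly la r i \is 1.-homog.
Proof.
have XH (n : 'I_5) : ('X_n : {mpoly k[5]}) \is 1.-homog by rewrite dhomogX /= mdeg1.
by move: i; apply: ord5P; rewrite /linpoly !vec5E ?dhomogZ ?dhomogD ?dhomogZ.
Qed.

Section OnCurve.
Variables (a b c d a2 b2 c2 d2 la r : k).
Hypothesis la0 : la != 0.
Hypotheses (Ea : a = la ^+ 3 * a2) (Eb : b = la * b2) (Ec : c = la^-1 * c2).
Hypothesis Ed : r ^+ 2 + r = d + d2.

Lemma linmap_morphism :
  morphism_over f (curve f a b c d) (curve f a2 b2 c2 d2) (linmap f la r).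
Proof.
split=> P PC; last first.
  exists 1%N, (linpoly la r); split=> //; first exact: linpoly_homog.
  by rewrite linmap_neq0 ?coords_neq0.
apply/curve_pt; first by rewrite linmap_neq0 ?coords_neq0.
move/curve_coords: PC; move: (coords P) => u [h1 h2 h3 h4].
have fla : f la != 0 by rewrite fmorph_eq0.
rewrite /on_cone !evalv_linpoly !vec5E; split.
- by transitivity (f la ^+ 4 * (u 0 (inord 0) * u 0 (inord 2))); [|rewrite h1]; ring.
- by transitivity (f la ^+ 3 * (u 0 (inord 0) * u 0 (inord 3))); [|rewrite h2]; ring.
- by transitivity (f la ^+ 2 * (u 0 (inord 1) * u 0 (inord 3))); [|rewrite h3]; ring.
(* The cross term 2 r u2 u4 vanishes; the shift by r contributes (r^2 + r) u2^2, which accounts for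
   the change of d because u2^2 = u1 u3. *)
transitivity (f la ^+ 2 * (u 0 (inord 4) ^+ 2 + u 0 (inord 2) * u 0 (inord 4)
   + (f r ^+ 2 + f r) * u 0 (inord 2) ^+ 2)); first by ring: K2.
have -> : f r ^+ 2 + f r = f d + f d2 by rewrite -rmorphXn -!rmorphD Ed.
rewrite h4 -h3 Ea Eb Ec !(rmorphXn, rmorphD, rmorphM) fmorphV /=.
by field: K2.
Qed.
End OnCurve.

Lemma linmap_isomorphism a b c d a2 b2 c2 d2 la r : la != 0 ->
  a = la ^+ 3 * a2 -> b = la * b2 -> c = la^-1 * c2 -> r ^+ 2 + r = d + d2 ->
  isomorphism_over f (curve f a b c d) (curve f a2 b2 c2 d2) (linmap f la r).
Proof.
move=> la0 Ea Eb Ec Ed; split; first exact: linmap_morphism.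
exists (linmap f la^-1 r); split.
- apply: linmap_morphism; rewrite ?invr_eq0 //.
  + by rewrite Ea; field.
  + by rewrite Eb; field.
  + by rewrite Ec invrK mulVKf.
  + by rewrite Ed addrC.
- by move=> P _; apply: linmap_inv.
by move=> P _; rewrite -{1}(invrK la) linmap_inv // invr_eq0.
Qed.

Lemma linmap_id P : linmap f 1 0 P = P.
Proof.
rewrite -[in RHS](coordsK P) /linmap; congr pt; apply/rowP=> i.
rewrite evalv_linpoly rmorph0 rmorph1; move: i; apply: ord5P; rewrite !vec5E; ring.
Qed.

Lemma linmap_hyp_inv P : linmap f 1 1 P = hyp_inv P.
Proof.
rewrite /linmap /hyp_inv; congr pt; apply/rowP=> i.
rewrite evalv_linpoly rmorph1 mxE; move: i.
by apply: ord5P; rewrite !vec5E inordK //= ?expr1n ?mul1r.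
Qed.

Lemma iter_hyp_inv e P : iter e (@hyp_inv K) P = linmap f 1 (odd e)%:R P.
Proof.
elim: e => [|e /= ->]; first by rewrite linmap_id.
case: (odd e); rewrite /= ?linmap_id -?linmap_hyp_inv //.
by rewrite -{1}[1]invr1 linmap_inv ?oner_neq0 // linmap_id.
Qed.

Lemma isomorphism_over_ext n m (X : pred (projpt K n)) (Y : pred (projpt K m)) phi phi' :
  {in X, phi =1 phi'} -> isomorphism_over f X Y phi' -> isomorphism_over f X Y phi.
Proof.
move=> E [[phiXY loc] [psi [psi_mor phiK psiK]]]; split.
  split=> P PX; first by rewrite E ?phiXY.
  have [e [F [Fe F0 FE]]] := loc P PX.
  by exists e, F; split=> // Q QX FQ; rewrite E ?FE.
exists psi; split=> // P PX; first by rewrite E ?phiK.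
by rewrite E ?psiK //; case: psi_mor => + _; apply.
Qed.
End LinearMaps.

(** * Isomorphisms and automorphisms *)

Lemma isomorphism_linmap (k : fieldType) (K : closedFieldType) (f : {rmorphism k -> K})
    (a b c d a2 b2 c2 d2 : k) phi : 2 = 0 :> k ->
  c != 0 -> a2 != 0 -> c2 != 0 ->
  isomorphism_over f (curve f a b c d) (curve f a2 b2 c2 d2) phi ->
  exists la r, [/\ la != 0, {in curve f a b c d, phi =1 linmap f la r}
  & [/\ a = la ^+ 3 * a2, b = la * b2, c = la^-1 * c2 & r ^+ 2 + r = d + d2]].
Proof.
move=> k2 c0 a20 c20 [phi_mor [psi [psi_mor phiK _]]].
have [F [j [L [J [y [D [j_inj j_frac [yE Lspan Lfree der [D_hL Dx]]]]]]]]] :=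
  function_field_exists a b d k2 c0.
exact: (morphism_linmap j_inj j_frac k2 c0 yE Lspan Lfree der D_hL Dx
  a20 c20 phi_mor psi_mor phiK).
Qed.

Theorem proposition14 (k : fieldType) (k_char2 : 2%N \in [pchar k])
    (k_perfect : perfect_field k)
    (K : closedFieldType) (f : {rmorphism k -> K})
    (K_closure : algebraic_closure f) :
  (forall a b c d a' b' c' d' : k,
     a != 0 -> c != 0 -> a' != 0 -> c' != 0 ->
     isomorphic_over f (curve f a' b' c' d') (curve f a b c d) <->
     exists lambda : k,
       [/\ lambda != 0, a' = lambda ^+ 3 * a, b' = lambda * b,
           c' = lambda^-1 * c & eq_mod_AS d' d])
  /\
  (forall a b c d : k, a != 0 -> c != 0 ->
     forall phi : projpt K 4 -> projpt K 4,
       automorphism_over f (curve f a b c d) phi <->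
       generated_by_involution (curve f a b c d) (@hyp_inv K) phi).
Proof.
have k2 : 2 = 0 :> k := pcharf0 k_char2.
split=> [a b c d a' b' c' d' a0 c0 a'0 c'0 | a b c d a0 c0 phi].
  split=> [[phi /(isomorphism_linmap k2 c'0 a0 c0)[la [r [la0 _ [Ea Eb Ec Ed]]]]]|].
    by exists la; split=> //; exists r; rewrite (opp2 k2) -Ed addrC.
  case=> la [la0 Ea Eb Ec [r Ed]]; exists (linmap f la r).
  by apply: linmap_isomorphism => //; rewrite addrC -Ed (opp2 k2).
split=> [/(isomorphism_linmap k2 c0 a0 c0)[la [r [la0 phiE [Ea Eb Ec Ed]]]] | [e phiE]].
  (* The coefficient c determines la: a gives only la^3 = 1, and b may vanish. *)
  have la1 : la = 1.
    by apply: invr_inj; apply: (mulIf c0); rewrite invr1 mul1r -Ec.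
  (* With equal fourth coordinates r^2 + r = 0, and the two roots give the identity and the
     involution. *)
  have /eqP : r * (r + 1) = 0 by transitivity (d + d); [rewrite -Ed; ring | ring: k2].
  rewrite mulf_eq0 => /orP[/eqP r0 | /eqP r1].
    by exists 0%N => P PC; rewrite phiE // la1 r0 linmap_id.
  exists 1%N => P PC; rewrite phiE // la1 (add_eq0_2 k2 r1).
  exact: linmap_hyp_inv.
(* Conversely, a power of the involution depends only on the parity of its exponent and is the
   linear map with la = 1 and r equal to 0 or 1. *)
apply: (isomorphism_over_ext (phi' := linmap f 1 (odd e)%:R)).
  by move=> P PC; rewrite phiE // (iter_hyp_inv f k2).
apply: linmap_isomorphism; rewrite ?oner_neq0 ?expr1n ?invr1 ?mul1r //.
have -> : d + d = 0 by ring: k2.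
by case: (odd e); rewrite /= ?expr1n ?expr0n ?addr0.
Qed.
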